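(* The following identity of power series in $z$ holds: \begin{align*} E(z) + i F(z) = {} & - \Big( A\Big( \frac{z}{4} \Big) - 3 A \Big( \frac{z}{2} \Big) + 2 A(z) + \log(2) \Big) \cdot \frac{\pi z}{2} \tan\Big( \frac{\pi z}{2} \Big) \\ & - z \Big( \frac{1}{2} A'\Big( \frac{z}{2} \Big) - 2 A'(z) + \pi D(z) \Big) \\ & + i \Big( 2 z \beta(2) - 2 z D'(z) + 2 \cdot \frac{\pi z}{2} \tan\Big(\frac{\pi z}{2} \Big) D(z) \Big) . \end{align*}
   Context: For $r\ge 1$, $\varepsilon_j,\sigma_j\in\{\pm1\}$ and positive integers $s_j$, the alternating multiple mixed value is $$M^{\varepsilon_1,\ldots,\varepsilon_r}_{\sigma_1,\ldots,\sigma_r}(s_1,\ldots,s_r)=\sum_{m_1>\cdots>m_r>0}\ \prod_{j=1}^r \frac{(1+\varepsilon_j(-1)^{m_j})\,\sigma_j^{(2m_j+1-\varepsilon_j)/4}}{m_j^{s_j}},$$ where terms with a vanishing factor $1+\varepsilon_j(-1)^{m_j}$ are $0$ (so $\varepsilon_j=1$, written ''ev'', forces $m_j$ even and $\varepsilon_j=-1$, written ''od'', forces $m_j$ odd). The alternating multiple $T$ and $S$ values are $T^{\sigma_1,\ldots,\sigma_r}(s_1,\ldots,s_r)=M^{\ldots,\mathrm{ev},\mathrm{od},\mathrm{ev},\mathrm{od}}_{\sigma_1,\ldots,\sigma_r}(s_1,\ldots,s_r)$ and $S^{\sigma_1,\ldots,\sigma_r}(s_1,\ldots,s_r)=M^{\ldots,\mathrm{od},\mathrm{ev},\mathrm{od},\mathrm{ev}}_{\sigma_1,\ldots,\sigma_r}(s_1,\ldots,s_r)$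 (alternating parities, the last index $m_r$ being odd for $T$ and even for $S$). The signs are indicated by writing a bar over $s_j$ if and only if $\sigma_j=-1$; $\{a\}_n$ denotes $a$ repeated $n$ times. $\zeta$ is the Riemann zeta function and $\beta(s)=\sum_{n\ge1}(-1)^{n-1}(2n-1)^{-s}$ is the Dirichlet beta function. Generating series: $$E(z)=\sum_{m=0}^\infty S(2,\{1\}_{2m},\overline{1})z^{2m+2},\qquad F(z)=\sum_{m=0}^\infty T(2,\{1\}_{2m+1},\overline{1})z^{2m+3},$$ $$A(z)=\sum_{k=1}^\infty\zeta(2k+1)z^{2k},\qquad D(z)=\sum_{k=1}^\infty\beta(2k)z^{2k-1}.$$ Primes denote derivatives with respect to the argument. *)

(* Defs.v *)
From Stdlib Require Export Reals ZArith List.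
From Coquelicot Require Export Coquelicot.
Export ListNotations.
Open Scope R_scope.

Inductive sign : Set := Plus | Minus.

Definition sgn (e : sign) : Z := match e with Plus => 1%Z | Minus => (-1)%Z end.

Definition sign_opp (e : sign) : sign :=
  match e with Plus => Minus | Minus => Plus end.

Notation ev := Plus (only parsing).
Notation od := Minus (only parsing).

(** The factor (1 + eps (-1)^m) sigma^((2m+1-eps)/4) / m^s.  The exponent is an
    integer whenever 1 + eps (-1)^m is nonzero; otherwise [Z.div] rounds it and
    the factor is 0 in any case. *)
Definition mixed_factor (eps sigma : sign) (s m : nat) : R :=
  (1 + IZR (sgn eps) * (-1) ^ m)
  * IZR (sgn sigma ^ ((2 * Z.of_nat m + 1 - sgn eps) / 4))
  / INR m ^ s.

(** The index list [(eps_1, sigma_1, s_1); ...; (eps_r, sigma_r, s_r)] is in the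
    order of the outermost (largest) summation variable first:
    [mixed_sum l N] is the sum over N >= m_1 > ... > m_r > 0. *)
Fixpoint mixed_sum (l : list (sign * sign * nat)) (N : nat) : R :=
  match l with
  | [] => 1
  | (eps, sigma, s) :: l' =>
      sum_n_m (fun m => mixed_factor eps sigma s m * mixed_sum l' (m - 1)) 1 N
  end.

Definition mixed_value (l : list (sign * sign * nat)) : R :=
  real (Lim_seq (mixed_sum l)).

(** Adds alternating parities, ending with the parity [last]. *)
Fixpoint alternate (last : sign) (l : list (sign * nat))
  : list (sign * sign * nat) :=
  match l with
  | [] => []
  | (sigma, s) :: l' =>
      (if Nat.even (length l') then last else sign_opp last, sigma, s)
        :: alternate last l'
  end.

Definition T_value (l : list (sign * nat)) : R := mixed_value (alternate od l).
Definition S_value (l : list (sign * nat)) : R := mixed_value (alternate ev l).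

Definition unbarred (s : nat) : sign * nat := (Plus, s).
Definition barred (s : nat) : sign * nat := (Minus, s).

(** Only used at integers s >= 2, where the series converges. *)
Definition zeta (s : nat) : R := Series (fun n => / INR (n + 1) ^ s).

(** The summation index is shifted by one: n here is n - 1 in the usual
    sum over n >= 1 of (-1)^(n-1) (2n-1)^(-s). *)
Definition beta (s : nat) : R := Series (fun n => (-1) ^ n / INR (2 * n + 1) ^ s).

(** Formal power series are coefficient sequences [nat -> R], as in the [PS_*]
    operations of Coquelicot. *)

(** The series sum_(m >= 0) c_m z^(2m+d). *)
Definition PS_step2 (d : nat) (c : nat -> R) (n : nat) : R :=
  if (Nat.leb d n && Nat.even (n - d))%bool then c (Nat.div2 (n - d)) else 0.

(** The series a(cz). *)
Definition PS_dilate (c : R) (a : nat -> R) (n : nat) : R := c ^ n * a n.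

Definition PS_const (c : R) (n : nat) : R :=
  match n with O => c | S _ => 0 end.

Definition PS_taylor (f : R -> R) (n : nat) : R :=
  Derive_n f n 0 / INR (fact n).

Definition E_series : nat -> R :=
  PS_step2 2 (fun m => S_value (unbarred 2 :: repeat (unbarred 1) (2 * m) ++ [barred 1])).

Definition F_series : nat -> R :=
  PS_step2 3 (fun m => T_value (unbarred 2 :: repeat (unbarred 1) (2 * m + 1) ++ [barred 1])).

(** A and D are sums over k >= 1, reindexed by k = m + 1. *)
Definition A_series : nat -> R :=
  PS_step2 2 (fun m => zeta (2 * (m + 1) + 1)).

Definition D_series : nat -> R :=
  PS_step2 1 (fun m => beta (2 * (m + 1))).

(** The series of (pi z / 2) tan (pi z / 2). *)
Definition ztan_series : nat -> R :=
  PS_dilate (PI / 2) (PS_incr_1 (PS_taylor tan)).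

Declare Scope ps_scope.
Delimit Scope ps_scope with ps.
Notation "a + b" := (@PS_plus R_AbsRing R_NormedModule a%ps b%ps) : ps_scope.
Notation "a - b" := (@PS_minus R_AbsRing R_NormedModule a%ps b%ps) : ps_scope.
Notation "- a" := (@PS_opp R_AbsRing R_NormedModule a%ps) : ps_scope.
Notation "a * b" := (PS_mult a%ps b%ps) : ps_scope.
Notation "c '*:' a" := (@PS_scal R_AbsRing R_NormedModule c%R a%ps)
  (at level 40, left associativity) : ps_scope.

(** The complex power series a(z) + i b(z). *)
Definition PS_complex (a b : nat -> R) (n : nat) : C :=
  (RtoC (a n) + Ci * RtoC (b n))%C.

(* Main.v *)
Require Import Defs.
From Stdlib Require Import Lra Lia.

(** Let N = 2n + 1 run over the odd positive integers. The proof first writes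
    every coefficient of E and F as a single sum over N, and then evaluates
    these sums by partial fractions. A barred 1 is written -1 below.

    Duality. Let J(n, m) be the integral over [0, 1] of
    u^(2n) ((1 - u) / (1 + u))^m. Integration by parts gives
    J(n, m - 1) - J(n, m + 1) = (2N / m) J(n, m), so that summing (2 / m) J(n, m)
    over the m > m' of the parity opposite to that of m' telescopes to
    J(n, m') / N. Moreover the sum of 2 J(n, m) over n is 1 / m. In the multiple
    sum S(2, 1, ..., 1, -1) or T(2, 1, ..., 1, -1), one of the two factors 1 / m
    of the outermost variable is replaced by this sum over n; the outer variables
    can then be summed one after the other, each at the cost of a factor 1 / N,
    and the innermost alternating sum is a geometric series under the integral.
    This gives ([S_value_duality], [T_value_duality])
      S(2, {1}_(2m), -1) = -4 sum_N phi(N) / N^(2m + 2),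
      T(2, {1}_(2m + 1), -1) = -4 sum_N psi(N) / N^(2m + 3),
    where phi(N) and psi(N) are the integrals over [0, 1] of
    u^N (1 - u) / ((1 + u)(1 + u^2)) and of u^N / (1 + u^2).

    Kernel sums. Expanding in geometric series, phi(N) is the sum of w_j / (N + j)
    over j > 0, with weights w_j = 1, -2, 1, 0 of period 4, and the coefficients of
    A(z/4) - 3 A(z/2) + 2 A(z) + log 2 are the sums of 2 w_j / j^(2i + 1). Since
    (pi z / 2) tan (pi z / 2) is the sum of 2 z^2 / (N^2 - z^2), the product in the
    real part differs from E only by 4 times the double sums over N and j of w_j times
      (N^-p - j^-p) / (j^2 - N^2)    (p / 2 N^(-p - 2) if j = N)
    with p odd. The two parts of this kernel are summed separately, each over the
    variable absent from the numerator: the sums of 1 / (j^2 - N^2) over the odd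
    j <> N, over the odd N for j even, and over j congruent to 2 modulo 4 are
    1 / (4N^2), 0 and (-1)^n pi / (8N) ([kernel_sum_plain], [kernel_sum_even],
    [phi_sum]). The imaginary part is the same computation with p even and the
    weights (-1)^m on j = 2m + 1, for which the inner sum produces psi(N)
    ([kernel_sum_alternating], [lam_beta_convolution]).

    Tangent. With all weights equal to 1 and p even, the kernel sums say that the
    sum T(z) of 2z / (N^2 - z^2) satisfies T' = c + T^2 with c = T'(0), so that it
    is a tangent function; the value T(1/2) = pi / 2, which is Leibniz's series, fixes the
    constant ([PS_taylor_tan]). *)

(** * Series *)

Lemma is_series_Rplus (a b : nat -> R) (la lb : R) :
  is_series a la -> is_series b lb ->
  is_series (fun n => a n + b n) (la + lb).
Proof. exact (is_series_plus a b la lb). Qed.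

Lemma is_series_Rscal (c : R) (a : nat -> R) (l : R) :
  is_series a l -> is_series (fun n => c * a n) (c * l).
Proof. exact (is_series_scal c a l). Qed.

Lemma is_series_Rminus (a b : nat -> R) (la lb : R) :
  is_series a la -> is_series b lb ->
  is_series (fun n => a n - b n) (la - lb).
Proof. exact (is_series_minus a b la lb). Qed.

Lemma is_series_eq (a b : nat -> R) (la lb : R) :
  is_series a la -> (forall n, a n = b n) -> la = lb -> is_series b lb.
Proof. intros H E <-. exact (is_series_ext a b la E H). Qed.

Lemma is_series_shift (a : nat -> R) (l : R) :
  is_series (fun n => a (S n)) (l - a O) <-> is_series a l.
Proof.
  split; intros H.
  - apply is_series_decr_1. exact H.
  - apply is_series_incr_1. change (is_series a (l - a O + a O)).
    replace (l - a O + a O) with l by ring. exact H.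
Qed.

Lemma is_series_limit_unique (a : nat -> R) (l l' : R) :
  is_series a l -> is_series a l' -> l = l'.
Proof.
  intros H H'. rewrite <- (is_series_unique _ _ H). exact (is_series_unique _ _ H').
Qed.

Lemma Series_is (a : nat -> R) : ex_series a -> is_series a (Series a).
Proof. apply Series_correct. Qed.

Lemma ex_series_le_R (a b : nat -> R) :
  (forall n, Rabs (a n) <= b n) -> ex_series b -> ex_series a.
Proof. exact (ex_series_le a b). Qed.

Lemma sum_n_S (f : nat -> R) (M : nat) : sum_n f (S M) = sum_n f M + f (S M) :> R.
Proof. exact (sum_Sn f M). Qed.

Lemma sum_n_eq (f h : nat -> R) (M : nat) :
  (forall m, f m = h m) -> sum_n f M = sum_n h M.
Proof. intros H. exact (sum_n_ext f h M H). Qed.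

Lemma sum_n_eq_loc (f h : nat -> R) (M : nat) :
  (forall m, (m <= M)%nat -> f m = h m) -> sum_n f M = sum_n h M.
Proof. exact (sum_n_ext_loc f h M). Qed.

Lemma sum_n_Rscal (c : R) (f : nat -> R) (M : nat) :
  sum_n (fun m => c * f m) M = c * sum_n f M :> R.
Proof. exact (sum_n_mult_l (K := R_Ring) c f M). Qed.

Lemma sum_n_Rplus (f h : nat -> R) (M : nat) :
  sum_n (fun m => f m + h m) M = sum_n f M + sum_n h M :> R.
Proof. exact (sum_n_plus f h M). Qed.

Lemma sum_n_nonneg_incr (a : nat -> R) (n m : nat) :
  (forall k, 0 <= a k) -> (n <= m)%nat -> sum_n a n <= sum_n a m.
Proof.
  intros Ha. induction 1 as [|m _ IH]; [lra|].
  rewrite sum_Sn. unfold plus; simpl. generalize (Ha (S m)); lra.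
Qed.

Lemma sum_n_le_limit (a : nat -> R) (l : R) (n : nat) :
  (forall k, 0 <= a k) -> is_series a l -> sum_n a n <= l.
Proof.
  intros Ha H.
  refine (is_lim_seq_le_loc (fun _ => sum_n a n) (sum_n a) (sum_n a n) l _ _ H).
  - exists n. intros m Hm. now apply sum_n_nonneg_incr.
  - apply is_lim_seq_const.
Qed.

Lemma bounded_sums_ex_series (a : nat -> R) (M : R) :
  (forall k, 0 <= a k) -> (forall n, sum_n a n <= M) ->
  ex_series a /\ Series a <= M.
Proof.
  intros Ha HM.
  assert (E : ex_series a).
  { destruct (ex_finite_lim_seq_incr (sum_n a) M) as [l Hl]; trivial.
    - intros n. apply sum_n_nonneg_incr; trivial; lia.
    - exists l. exact Hl. }
  split; trivial.
  refine (is_lim_seq_le (sum_n a) (fun _ => M) (Series a) M HM _ _).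
  - exact (Series_is a E).
  - apply is_lim_seq_const.
Qed.

Lemma Series_nonneg (a : nat -> R) :
  (forall k, 0 <= a k) -> ex_series a -> 0 <= Series a.
Proof.
  intros Ha E. apply Rle_trans with (sum_n a 0).
  - rewrite sum_O. apply Ha.
  - apply sum_n_le_limit; trivial. now apply Series_is.
Qed.

Lemma is_series_sum_n (a : nat -> nat -> R) (l : nat -> R) (n : nat) :
  (forall j, is_series (fun i => a i j) (l j)) ->
  is_series (fun i => sum_n (a i) n) (sum_n l n).
Proof.
  intros H. induction n as [|n IH].
  - rewrite sum_O. apply (is_series_eq (fun i => a i O) _ (l O)); trivial.
    intros i. now rewrite sum_O.
  - rewrite sum_Sn. apply (is_series_eq (fun i => sum_n (a i) n + a i (S n)) _ (sum_n l n + l (S n))); trivial.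
    + now apply is_series_Rplus.
    + intros i. now rewrite sum_Sn.
Qed.

(** One half of Tonelli's theorem; the other half is the same statement with the
    indices exchanged. *)
Lemma Fubini_nonneg_le (a : nat -> nat -> R) :
  (forall i j, 0 <= a i j) ->
  (forall i, ex_series (a i)) -> ex_series (fun i => Series (a i)) ->
  (forall j, ex_series (fun i => a i j)) /\
  ex_series (fun j => Series (fun i => a i j)) /\
  Series (fun j => Series (fun i => a i j)) <= Series (fun i => Series (a i)).
Proof.
  intros Ha Hr Hs.
  assert (Hc : forall j, ex_series (fun i => a i j)).
  { intros j. apply (ex_series_le_R _ (fun i => Series (a i))); trivial.
    intros i. rewrite Rabs_pos_eq by trivial.
    apply Rle_trans with (sum_n (a i) j).
    - destruct j as [|j]; [rewrite sum_O; lra|].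
      rewrite sum_Sn. unfold plus; simpl.
      assert (0 <= sum_n (a i) j); [|lra].
      apply Rle_trans with (sum_n (a i) 0).
      + rewrite sum_O; trivial.
      + apply sum_n_nonneg_incr; trivial; lia.
    - apply sum_n_le_limit; trivial. now apply Series_is. }
  split; trivial.
  apply bounded_sums_ex_series.
  - intros j. now apply Series_nonneg.
  - intros n.
    assert (H := is_series_sum_n a (fun j => Series (fun i => a i j)) n
                   (fun j => Series_is _ (Hc j))).
    rewrite <- (is_series_unique _ _ H).
    apply Series_le; trivial. intros i. split.
    + apply Rle_trans with (sum_n (a i) 0).
      * rewrite sum_O; trivial.
      * apply sum_n_nonneg_incr; trivial; lia.
    + apply sum_n_le_limit; trivial. now apply Series_is.
Qed.

Lemma Fubini_nonneg (a : nat -> nat -> R) :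
  (forall i j, 0 <= a i j) ->
  (forall i, ex_series (a i)) -> ex_series (fun i => Series (a i)) ->
  (forall j, ex_series (fun i => a i j)) /\
  is_series (fun j => Series (fun i => a i j)) (Series (fun i => Series (a i))).
Proof.
  intros Ha Hr Hs.
  destruct (Fubini_nonneg_le a Ha Hr Hs) as (Hc & He & Hle).
  destruct (Fubini_nonneg_le (fun j i => a i j) (fun j i => Ha i j) Hc He)
    as (_ & _ & Hge).
  split; trivial.
  replace (Series (fun i => Series (a i)))
    with (Series (fun j => Series (fun i => a i j))); [now apply Series_is|].
  apply Rle_antisym; trivial.
Qed.

(** The order of summation in an absolutely convergent double series can be exchanged. *)
Lemma Fubini_series (a : nat -> nat -> R) :
  (forall i, ex_series (fun j => Rabs (a i j))) ->
  ex_series (fun i => Series (fun j => Rabs (a i j))) ->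
  ex_series (fun i => Series (a i)) /\
  (forall j, ex_series (fun i => a i j)) /\
  is_series (fun j => Series (fun i => a i j)) (Series (fun i => Series (a i))).
Proof.
  intros Hr Hs.
  (* The terms are the difference of the nonnegative arrays |a| and |a| - a. *)
  set (p := fun i j => Rabs (a i j) - a i j).
  assert (Hr' : forall i, ex_series (a i)) by (intros i; now apply ex_series_Rabs).
  assert (Hp : forall i j, 0 <= p i j).
  { intros i j. unfold p. generalize (Rle_abs (a i j)); lra. }
  assert (Hsa : ex_series (fun i => Series (a i))).
  { apply (ex_series_le_R _ (fun i => Series (fun j => Rabs (a i j)))); trivial.
    intros i. now apply Series_Rabs. }
  assert (Hpr : forall i, is_series (p i) (Series (fun j => Rabs (a i j)) - Series (a i))).
  { intros i. apply is_series_Rminus; now apply Series_is. }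
  assert (Hps : is_series (fun i => Series (p i))
     (Series (fun i => Series (fun j => Rabs (a i j))) - Series (fun i => Series (a i)))).
  { apply (is_series_eq _ _ _ _ (is_series_Rminus _ _ _ _ (Series_is _ Hs) (Series_is _ Hsa))); trivial.
    intros i. symmetry. apply is_series_unique, Hpr. }
  destruct (Fubini_nonneg (fun i j => Rabs (a i j)) (fun i j => Rabs_pos _) Hr Hs)
    as (C1 & S1).
  destruct (Fubini_nonneg p Hp (fun i => ex_intro _ _ (Hpr i)) (ex_intro _ _ Hps))
    as (C2 & S2).
  assert (Hc : forall j, is_series (fun i => a i j)
     (Series (fun i => Rabs (a i j)) - Series (fun i => p i j))).
  { intros j.
    apply (is_series_eq _ _ _ _ (is_series_Rminus _ _ _ _ (Series_is _ (C1 j)) (Series_is _ (C2 j)))); trivial.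
    intros i. unfold p. ring. }
  split; [trivial|]. split; [intros j; eexists; apply Hc|].
  apply (is_series_eq _ _ _ _ (is_series_Rminus _ _ _ _ S1 S2)).
  - intros j. symmetry. apply is_series_unique, Hc.
  - rewrite (is_series_unique _ _ Hps). ring.
Qed.

Lemma is_lim_seq_even_odd (u : nat -> R) (l : R) :
  is_lim_seq (fun n => u (2 * n)%nat) l ->
  is_lim_seq (fun n => u (2 * n + 1)%nat) l ->
  is_lim_seq u l.
Proof.
  intros H0 H1. apply is_lim_seq_spec. apply is_lim_seq_spec in H0, H1.
  intros eps. destruct (H0 eps) as [N0 K0], (H1 eps) as [N1 K1].
  exists (2 * N0 + 2 * N1 + 1)%nat. intros n Hn.
  destruct (Nat.Even_or_Odd n) as [[k ->]|[k ->]].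
  - apply K0. lia.
  - apply K1. lia.
Qed.

Lemma eventually_linear (a b : nat) : (0 < a)%nat ->
  filterlim (fun n => a * n + b)%nat eventually eventually.
Proof. intros Ha P [N HN]. exists N. intros n Hn. apply HN. nia. Qed.

Lemma sum_n_even_odd (f : nat -> R) (n : nat) :
  sum_n f (2 * n + 1) =
  sum_n (fun k => f (2 * k)%nat) n + sum_n (fun k => f (2 * k + 1)%nat) n.
Proof.
  induction n as [|n IH].
  - simpl. now rewrite sum_Sn, !sum_O.
  - replace (2 * S n + 1)%nat with (S (S (2 * n + 1))) by lia.
    rewrite !sum_Sn, IH. unfold plus; simpl.
    replace (S (n + (n + 0) + 1)) with (n + S (n + 0) + 1)%nat by lia.
    replace (S (n + S (n + 0) + 1)) with (S (n + S (n + 0) + 1))%nat by lia.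
    replace (S (n + S (n + 0))) with (n + S (n + 0) + 1)%nat by lia. ring.
Qed.

Lemma is_series_pairs (f : nat -> R) (l : R) :
  is_series f l -> is_series (fun j => f (2 * j)%nat + f (2 * j + 1)%nat) l.
Proof.
  intros H.
  apply (is_lim_seq_ext (fun n => sum_n f (2 * n + 1)) (sum_n _) l).
  - intros n. rewrite sum_n_even_odd. symmetry.
    exact (sum_n_plus (fun j => f (2 * j)%nat) (fun j => f (2 * j + 1)%nat) n).
  - apply (is_lim_seq_subseq (sum_n f)); trivial. apply eventually_linear. lia.
Qed.

Lemma is_series_even_odd (f : nat -> R) (l0 l1 l : R) :
  is_series (fun k => f (2 * k)%nat) l0 ->
  is_series (fun k => f (2 * k + 1)%nat) l1 ->
  is_series f l -> l = l0 + l1.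
Proof.
  intros H0 H1 H.
  exact (is_series_limit_unique _ _ _ (is_series_pairs f l H) (is_series_Rplus _ _ _ _ H0 H1)).
Qed.

Lemma is_series_telescope (f : nat -> R) :
  is_lim_seq f 0 -> is_series (fun n => f n - f (S n)) (f O).
Proof.
  intros H.
  assert (E : forall n, sum_n (fun n => f n - f (S n)) n = f O - f (S n)).
  { induction n as [|n IH]; [now rewrite sum_O|].
    rewrite sum_Sn, IH. unfold plus; simpl. ring. }
  apply (is_lim_seq_ext (fun n => f O - f (S n)) (sum_n (fun n => f n - f (S n))) (f O)).
  - intros n. now rewrite E.
  - replace (Finite (f O)) with (Finite (f O - 0)) by (f_equal; ring).
    apply is_lim_seq_minus'; [apply is_lim_seq_const|]. now apply (is_lim_seq_incr_1 f).
Qed.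

Lemma is_series_zero : is_series (fun _ : nat => 0) 0.
Proof.
  apply (is_series_eq _ _ _ _ (is_series_telescope _ (is_lim_seq_const 0))); trivial.
  intros _. ring.
Qed.

Lemma is_series_single (n : nat) (c : R) :
  is_series (fun m => if Nat.eq_dec m n then c else 0) c.
Proof.
  induction n as [|n IH]; apply is_series_shift; simpl.
  - apply (is_series_eq _ _ _ _ is_series_zero); [trivial|ring].
  - apply (is_series_eq _ _ _ _ IH); [|ring].
    intros m. destruct (Nat.eq_dec m n), (Nat.eq_dec (S m) (S n)); trivial; lia.
Qed.

Lemma is_lim_seq_inv_linear (a b : R) : 0 < a ->
  is_lim_seq (fun n => / (a * INR n + b)) 0.
Proof.
  intros Ha.
  apply (is_lim_seq_inv _ p_infty); [|discriminate].
  apply (is_lim_seq_plus _ _ p_infty b p_infty); try apply is_lim_seq_const; [|reflexivity].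
  apply is_lim_seq_spec. intros M.
  destruct (nfloor_ex (Rabs M / a)) as [N HN].
  { apply Rmult_le_pos; [apply Rabs_pos|]. apply Rlt_le, Rinv_0_lt_compat, Ha. }
  exists (S N). intros n Hn.
  apply le_INR in Hn. rewrite S_INR in Hn.
  apply Rle_lt_trans with (1 := Rle_abs M).
  replace (Rabs M) with (a * (Rabs M / a)) by (field; lra).
  apply Rmult_lt_compat_l; lra.
Qed.

(** Up to the factor 4, n^(-3/2) is dominated by a telescoping difference. *)
Lemma inv_sqrt_difference (x : R) : 1 <= x ->
  / (x * sqrt x) <= 4 * (/ sqrt x - / sqrt (x + 1)).
Proof.
  intros Hx.
  assert (Ha := sqrt_lt_R0 x ltac:(lra)). assert (Hb := sqrt_lt_R0 (x + 1) ltac:(lra)).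
  assert (Ea := sqrt_sqrt x ltac:(lra)). assert (Eb := sqrt_sqrt (x + 1) ltac:(lra)).
  set (a := sqrt x) in *. set (b := sqrt (x + 1)) in *.
  assert (Hab : a < b) by nra.
  assert (E : / a - / b = / (a * b * (a + b))).
  { replace (/ a - / b) with ((b * b - a * a) / (a * b * (a + b))).
    - rewrite Ea, Eb. unfold Rdiv. replace (x + 1 - x) with 1 by ring. ring.
    - field. repeat split; lra. }
  assert (0 < a * b * (a + b)) by (apply Rmult_lt_0_compat; nra).
  rewrite E. rewrite <- Ea.
  assert (0 < a * a * a) by (apply Rmult_lt_0_compat; nra).
  replace (/ (a * a * a)) with (4 * / (4 * (a * a * a))) by (field; lra).
  apply Rmult_le_compat_l; [lra|]. apply Rinv_le_contravar; trivial.
  assert (2 * (a * b) <= a * a + b * b) by nra.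
  assert (b * (a + b) <= 4 * (a * a)) by nra. nra.
Qed.

Lemma ex_series_three_halves :
  ex_series (fun n => / ((INR n + 1) * sqrt (INR n + 1))).
Proof.
  assert (L : is_lim_seq (fun n => / sqrt (INR n + 1)) 0).
  { apply (is_lim_seq_ext (fun n => sqrt (/ (1 * INR n + 1)))).
    - intros n. rewrite Rmult_1_l. apply sqrt_inv.
    - replace (Finite 0) with (Finite (sqrt 0)) by (now rewrite sqrt_0).
      apply (is_lim_seq_continuous sqrt _ 0).
      + apply continuity_pt_sqrt. lra.
      + apply is_lim_seq_inv_linear. lra. }
  assert (T := is_series_telescope _ L).
  apply (ex_series_le_R _ (fun n => 4 * (/ sqrt (INR n + 1) - / sqrt (INR (S n) + 1)))).
  - intros n. assert (Hn := pos_INR n). rewrite Rabs_pos_eq.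
    + rewrite S_INR. apply inv_sqrt_difference; lra.
    + apply Rlt_le, Rinv_0_lt_compat, Rmult_lt_0_compat; [lra|]. apply sqrt_lt_R0. lra.
  - eexists. apply is_series_Rscal. exact T.
Qed.

(** * Integrals over [0, 1] *)

Lemma ex_RInt_01 (f : R -> R) :
  (forall u, 0 <= u <= 1 -> continuous f u) -> ex_RInt f 0 1.
Proof.
  intros H. apply (ex_RInt_continuous (V := R_CompleteNormedModule)).
  intros u. rewrite Rmin_left, Rmax_right by lra. apply H.
Qed.

Lemma is_RInt_derive_01 (f df : R -> R) (l : R) :
  (forall u, 0 <= u <= 1 -> is_derive f u (df u)) ->
  (forall u, 0 <= u <= 1 -> continuous df u) ->
  l = f 1 - f 0 -> is_RInt df 0 1 l.
Proof.
  intros H C ->. apply (is_RInt_derive (V := R_CompleteNormedModule) f df);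
    intros u; rewrite Rmin_left, Rmax_right by lra; auto.
Qed.

Lemma RInt_ext_01 (f g : R -> R) :
  (forall u, 0 <= u <= 1 -> f u = g u) -> RInt f 0 1 = RInt g 0 1.
Proof.
  intros H. apply RInt_ext. intros u. rewrite Rmin_left, Rmax_right by lra.
  intros Hu. apply H. lra.
Qed.

Lemma is_RInt_ext_01 (f g : R -> R) (l : R) :
  (forall u, 0 <= u <= 1 -> f u = g u) -> is_RInt f 0 1 l -> is_RInt g 0 1 l.
Proof.
  intros H. apply is_RInt_ext. intros u. rewrite Rmin_left, Rmax_right by lra.
  intros Hu. apply H. lra.
Qed.

Lemma RInt_Rscal_01 (c : R) (f : R -> R) : ex_RInt f 0 1 ->
  RInt (fun u => c * f u) 0 1 = c * RInt f 0 1.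
Proof. exact (RInt_scal (V := R_CompleteNormedModule) f 0 1 c). Qed.

Lemma RInt_Rplus_01 (f g : R -> R) : ex_RInt f 0 1 -> ex_RInt g 0 1 ->
  RInt (fun u => f u + g u) 0 1 = RInt f 0 1 + RInt g 0 1.
Proof. exact (RInt_plus (V := R_CompleteNormedModule) f g 0 1). Qed.

Lemma RInt_Rminus_01 (f g : R -> R) : ex_RInt f 0 1 -> ex_RInt g 0 1 ->
  RInt (fun u => f u - g u) 0 1 = RInt f 0 1 - RInt g 0 1.
Proof. exact (RInt_minus (V := R_CompleteNormedModule) f g 0 1). Qed.

Lemma continuous_Rmult (f g : R -> R) (u : R) :
  continuous f u -> continuous g u -> continuous (fun u => f u * g u) u.
Proof. exact (continuous_mult (K := R_AbsRing) f g u). Qed.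

Lemma continuous_Rpow (f : R -> R) (n : nat) (u : R) :
  continuous f u -> continuous (fun u => f u ^ n) u.
Proof.
  intros H. induction n as [|n IH]; simpl.
  - apply continuous_const.
  - now apply continuous_Rmult.
Qed.

Lemma is_RInt_pow (j : nat) : is_RInt (fun u => u ^ j) 0 1 (/ (INR j + 1)).
Proof.
  assert (Hj := pos_INR j).
  apply (is_RInt_derive_01 (fun u => u ^ S j / (INR j + 1))).
  - intros u _. auto_derive; [trivial|].
    change (1 * (INR (S j) * u ^ j) * / (INR j + 1) = u ^ j).
    rewrite S_INR. field. lra.
  - intros u _. apply continuous_Rpow, continuous_id.
  - rewrite pow1, pow_ne_zero by discriminate. field. lra.
Qed.

Lemma is_RInt_pow_compl (j : nat) :
  is_RInt (fun u => (1 - u) ^ j) 0 1 (/ (INR j + 1)).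
Proof.
  assert (Hj := pos_INR j).
  apply (is_RInt_derive_01 (fun u => - (1 - u) ^ S j / (INR j + 1))).
  - intros u _. auto_derive; [trivial|].
    change (- (- (1) * (INR (S j) * (1 + - u) ^ j)) * / (INR j + 1) = (1 - u) ^ j).
    rewrite S_INR. unfold Rminus. field. lra.
  - intros u _. apply continuous_Rpow.
    apply (continuous_minus (V := R_NormedModule)); [apply continuous_const|apply continuous_id].
  - rewrite Rminus_diag, pow_ne_zero, Rminus_0_r, pow1 by discriminate. field. lra.
Qed.

(** Termwise integration of the geometric series with sum F and ratio q. The
    integrals of F (1 - q) q^j telescope, and the remainder, the integral of
    F q^(n + 1), is at most C / (n + 2). The bound v of q is u or 1 - u: the ratio
    may be 1 at one endpoint. *)
Lemma is_series_RInt_geom (F q v : R -> R) (C : R) :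
  (forall j, is_RInt (fun u => v u ^ j) 0 1 (/ (INR j + 1))) ->
  (forall u, 0 <= u <= 1 -> continuous F u) ->
  (forall u, 0 <= u <= 1 -> continuous q u) ->
  (forall u, 0 <= u <= 1 -> Rabs (F u) <= C) ->
  (forall u, 0 <= u <= 1 -> Rabs (q u) <= v u) ->
  is_series (fun j => RInt (fun u => F u * (1 - q u) * q u ^ j) 0 1) (RInt F 0 1).
Proof.
  intros Hv cF cq bF bq.
  assert (cR : forall n, ex_RInt (fun u => F u * q u ^ n) 0 1).
  { intros n. apply ex_RInt_01. intros u Hu.
    apply continuous_Rmult; auto. apply continuous_Rpow; auto. }
  assert (E : forall n, sum_n (fun j => RInt (fun u => F u * (1 - q u) * q u ^ j) 0 1) n
     = RInt F 0 1 - RInt (fun u => F u * q u ^ S n) 0 1).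
  { assert (T : forall j, RInt (fun u => F u * (1 - q u) * q u ^ j) 0 1 =
      RInt (fun u => F u * q u ^ j) 0 1 - RInt (fun u => F u * q u ^ S j) 0 1).
    { intros j. rewrite <- RInt_Rminus_01 by apply cR.
      apply RInt_ext_01. intros u _. simpl. ring. }
    induction n as [|n IH].
    - rewrite sum_O, T. f_equal. apply RInt_ext_01. intros u _. simpl. ring.
    - rewrite sum_Sn, IH, T. unfold plus; simpl. ring. }
  apply (is_lim_seq_ext (fun n => RInt F 0 1 - RInt (fun u => F u * q u ^ S n) 0 1)
           (sum_n _) (RInt F 0 1)).
  { intros n. now rewrite E. }
  replace (Finite (RInt F 0 1)) with (Finite (RInt F 0 1 - 0)) by (f_equal; ring).
  apply is_lim_seq_minus'; [apply is_lim_seq_const|].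
  apply is_lim_seq_abs_0.
  apply (is_lim_seq_le_le (fun _ => 0) _ (fun n => C * / (1 * INR n + 2))).
  - intros n. split; [apply Rabs_pos|].
    apply Rle_trans with (1 := abs_RInt_le _ 0 1 Rle_0_1 (cR (S n))).
    assert (HI : is_RInt (fun u => C * v u ^ S n) 0 1 (C * / (1 * INR n + 2))).
    { replace (1 * INR n + 2) with (INR (S n) + 1) by (rewrite S_INR; ring).
      exact (is_RInt_scal (V := R_NormedModule) _ 0 1 C _ (Hv (S n))). }
    rewrite <- (is_RInt_unique _ _ _ _ HI).
    apply RInt_le.
    + apply Rle_0_1.
    + apply ex_RInt_01. intros u Hu. apply continuous_comp.
      * apply continuous_Rmult; auto. apply continuous_Rpow; auto.
      * apply continuous_Rabs.
    + eexists; exact HI.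
    + intros u Hu. rewrite Rabs_mult, <- RPow_abs.
      apply Rmult_le_compat; try apply Rabs_pos.
      * apply pow_le, Rabs_pos.
      * apply bF. lra.
      * apply pow_incr. split; [apply Rabs_pos|]. apply bq. lra.
  - apply is_lim_seq_const.
  - replace (Finite 0) with (Rbar_mult C 0) by (simpl; f_equal; ring).
    apply is_lim_seq_scal_l. apply is_lim_seq_inv_linear. lra.
Qed.

(** Continuity of an explicit expression, from its differentiability. *)
Ltac cont := apply (@ex_derive_continuous R_AbsRing R_NormedModule); auto_derive;
  repeat split; trivial; try nra.

(** The integrals that express the values T and S. *)
Definition psi (N : nat) : R := RInt (fun u => u ^ N / (1 + u ^ 2)) 0 1.

Definition phi (N : nat) : R :=
  RInt (fun u => u ^ N * ((1 - u) / ((1 + u) * (1 + u ^ 2)))) 0 1.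

Lemma pow_01 (u : R) (n : nat) : 0 <= u <= 1 -> 0 <= u ^ n <= 1.
Proof.
  intros H. split; [apply pow_le; lra|]. rewrite <- (pow1 n). apply pow_incr; lra.
Qed.

Lemma is_RInt_pow_mult (N k m : nat) :
  is_RInt (fun u => u ^ N * (u ^ m) ^ k) 0 1 (/ (INR N + INR m * INR k + 1)).
Proof.
  replace (INR N + INR m * INR k) with (INR (N + m * k)) by (rewrite plus_INR, mult_INR; ring).
  apply (is_RInt_ext_01 (fun u => u ^ (N + m * k))); [|apply is_RInt_pow].
  intros u _. now rewrite pow_add, pow_mult.
Qed.

Lemma bound_inv_one (x y : R) : 0 <= x <= 1 -> 1 <= y -> Rabs (x / y) <= 1.
Proof.
  intros Hx Hy. rewrite Rabs_pos_eq.
  - apply Rmult_le_reg_r with y; [lra|]. unfold Rdiv. rewrite Rmult_assoc, Rinv_l; lra.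
  - apply Rmult_le_pos; [lra|]. apply Rlt_le, Rinv_0_lt_compat; lra.
Qed.

Lemma psi_series (N : nat) :
  is_series (fun m => (-1) ^ m / (INR N + 1 + 2 * INR m)) (psi N).
Proof.
  assert (HN := pos_INR N).
  apply (is_series_eq (fun j => RInt (fun u => u ^ N / (1 + u ^ 2) * (1 - - u ^ 2) * (- u ^ 2) ^ j) 0 1) _ (psi N)); trivial.
  - apply (is_series_RInt_geom _ (fun u => - u ^ 2) (fun u => u) 1); try exact is_RInt_pow.
    + intros u Hu. cont.
    + intros u Hu. cont.
    + intros u Hu. apply bound_inv_one; [now apply pow_01|nra].
    + intros u Hu. rewrite Rabs_Ropp, Rabs_pos_eq; nra.
  - intros m. assert (Hm := pos_INR m).
    apply is_RInt_unique.
    apply (is_RInt_ext_01 (fun u => (-1) ^ m * (u ^ N * (u ^ 2) ^ m))).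
    + intros u _. replace (- u ^ 2) with (-1 * u ^ 2) by ring.
      rewrite (Rpow_mult_distr (-1)). field. nra.
    + replace ((-1) ^ m / (INR N + 1 + 2 * INR m)) with
        (scal ((-1) ^ m) (/ (INR N + INR 2 * INR m + 1))).
      * apply (is_RInt_scal (V := R_NormedModule)). apply is_RInt_pow_mult.
      * unfold scal; simpl; unfold mult; simpl. field; repeat split; lra.
Qed.

(** With [psi_zero], this is Leibniz's series for pi / 4, two terms at a time. *)
Lemma psi_zero_series :
  is_series (fun j => / (4 * INR j + 1) - / (4 * INR j + 3)) (psi 0).
Proof.
  apply (is_series_eq (fun j => RInt (fun u => u ^ 0 / (1 + u ^ 2) * (1 - u ^ 4) * (u ^ 4) ^ j) 0 1) _ (psi 0)); trivial.
  - apply (is_series_RInt_geom _ (fun u => u ^ 4) (fun u => u) 1); try exact is_RInt_pow.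
    + intros u Hu. cont.
    + intros u Hu. cont.
    + intros u Hu. apply bound_inv_one; [now apply pow_01|nra].
    + intros u Hu. assert (H := pow_01 u 3 Hu). rewrite Rabs_pos_eq; [|apply pow_le; lra].
      replace (u ^ 4) with (u * u ^ 3) by ring. nra.
  - intros m. assert (Hm := pos_INR m).
    apply is_RInt_unique.
    apply (is_RInt_ext_01 (fun u => u ^ 0 * (u ^ 4) ^ m - u ^ 2 * (u ^ 4) ^ m)).
    + intros u _. field. nra.
    + assert (H := is_RInt_minus (V := R_NormedModule) _ _ _ _ _ _ (is_RInt_pow_mult 0 m 4) (is_RInt_pow_mult 2 m 4)).
      replace (/ (4 * INR m + 1) - / (4 * INR m + 3)) with
        (minus (/ (INR 0 + INR 4 * INR m + 1)) (/ (INR 2 + INR 4 * INR m + 1))); trivial.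
      unfold minus, plus, opp; simpl. field. repeat split; lra.
Qed.

(** The ratio is u^4, since (1 - u) / ((1 + u) (1 + u^2)) = (1 - u)^2 / (1 - u^4). *)
Lemma phi_series (N : nat) :
  is_series (fun j => / (INR N + (4 * INR j + 1)) - 2 * / (INR N + (4 * INR j + 2))
                      + / (INR N + (4 * INR j + 3))) (phi N).
Proof.
  assert (HN := pos_INR N).
  apply (is_series_eq (fun j => RInt (fun u => u ^ N * ((1 - u) / ((1 + u) * (1 + u ^ 2))) * (1 - u ^ 4) * (u ^ 4) ^ j) 0 1) _ (phi N)); trivial.
  - apply (is_series_RInt_geom _ (fun u => u ^ 4) (fun u => u) 1); try exact is_RInt_pow.
    + intros u Hu. cont.
    + intros u Hu. cont.
    + intros u Hu. rewrite Rabs_mult. apply Rle_trans with (1 * 1); [|lra].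
      apply Rmult_le_compat; try apply Rabs_pos.
      * assert (H := pow_01 u N Hu). rewrite Rabs_pos_eq; lra.
      * apply bound_inv_one; [lra|nra].
    + intros u Hu. assert (H := pow_01 u 3 Hu). rewrite Rabs_pos_eq; [|apply pow_le; lra].
      replace (u ^ 4) with (u * u ^ 3) by ring. nra.
  - intros m. assert (Hm := pos_INR m).
    apply is_RInt_unique.
    apply (is_RInt_ext_01 (fun u => u ^ N * (u ^ 4) ^ m - 2 * (u ^ (N + 1) * (u ^ 4) ^ m) + u ^ (N + 2) * (u ^ 4) ^ m)).
    + intros u Hu. rewrite !pow_add. field. nra.
    + assert (H := is_RInt_plus (V := R_NormedModule) _ _ _ _ _ _
       (is_RInt_minus (V := R_NormedModule) _ _ _ _ _ _ (is_RInt_pow_mult N m 4)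
         (is_RInt_scal (V := R_NormedModule) _ _ _ 2 _ (is_RInt_pow_mult (N + 1) m 4)))
         (is_RInt_pow_mult (N + 2) m 4)).
      match type of H with is_RInt _ _ _ ?l => match goal with |- is_RInt _ _ _ ?l' =>
        replace l' with l end end; trivial.
      rewrite !plus_INR.
      unfold minus, plus, opp, scal; simpl. unfold mult; simpl. field. repeat split; lra.
Qed.

Lemma psi_zero : psi 0 = PI / 4.
Proof.
  apply is_RInt_unique. apply (is_RInt_derive_01 atan).
  - intros u _. simpl pow. replace (1 / (1 + u * (u * 1))) with (/ (1 + u ^ 2)) by (simpl; field; nra).
    apply is_derive_Reals. replace (/ (1 + u ^ 2)) with (/ (1 + Rsqr u)) by (unfold Rsqr; f_equal; ring).
    replace (/ (1 + Rsqr u)) with (/ (1 + u ^ 2)) by (unfold Rsqr; f_equal; ring).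
    apply derivable_pt_lim_atan.
  - intros u _. cont.
  - rewrite atan_1, atan_0. lra.
Qed.

Lemma phi_zero : phi 0 = ln 2 / 2.
Proof.
  apply is_RInt_unique.
  apply (is_RInt_derive_01 (fun u => ln (1 + u) - ln (1 + u ^ 2) / 2)).
  - intros u Hu. auto_derive.
    + repeat split; nra.
    + field. nra.
  - intros u Hu. cont.
  - replace (1 + 0 ^ 2) with 1 by ring. replace (1 + 1 ^ 2) with 2 by ring.
    replace (1 + 1) with 2 by ring. rewrite Rplus_0_r, ln_1. lra.
Qed.

Lemma psi_step (N : nat) : psi N + psi (N + 2) = / (INR N + 1).
Proof.
  unfold psi. rewrite <- RInt_Rplus_01.
  - rewrite <- (is_RInt_unique _ _ _ _ (is_RInt_pow N)).
    apply RInt_ext_01. intros u _. rewrite pow_add. field. nra.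
  - apply ex_RInt_01. intros u _. cont.
  - apply ex_RInt_01. intros u _. cont.
Qed.

(** The odd number 2n + 1 as a real number. *)
Definition oddR (n : nat) : R := 2 * INR n + 1.

Lemma oddR_ge1 (n : nat) : 1 <= oddR n.
Proof. unfold oddR. generalize (pos_INR n). lra. Qed.

Lemma oddR_INR (n : nat) : oddR n = INR (2 * n + 1).
Proof. unfold oddR. rewrite plus_INR, mult_INR. simpl. ring. Qed.

(** The involution of [0, 1] under which dx / x and 2 dx / (1 - x^2) are exchanged
    up to sign. *)
Definition xi (u : R) : R := (1 - u) / (1 + u).

(** The connector of the duality, with u^(N - 1) = u^(2n) for N = 2n + 1. *)
Definition J (n m : nat) : R := RInt (fun u => u ^ (2 * n) * xi u ^ m) 0 1.

Lemma xi_bounds (u : R) : 0 <= u <= 1 -> 0 <= xi u <= 1 - u.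
Proof.
  intros H. unfold xi. split.
  - apply Rmult_le_pos; [lra|]. apply Rlt_le, Rinv_0_lt_compat. lra.
  - apply Rmult_le_reg_r with (1 + u); [lra|]. unfold Rdiv.
    rewrite Rmult_assoc, Rinv_l; nra.
Qed.

Lemma xi_cont (u : R) : 0 <= u <= 1 -> continuous xi u.
Proof. intros H. unfold xi. cont. Qed.

Lemma is_derive_eq (f : R -> R) (u l l' : R) :
  is_derive f u l -> l = l' -> is_derive f u l'.
Proof. now intros H <-. Qed.

Lemma is_derive_Rmult (f h : R -> R) (u df dh : R) :
  is_derive f u df -> is_derive h u dh ->
  is_derive (fun u => f u * h u) u (df * h u + f u * dh).
Proof.
  intros Hf Hh. exact (is_derive_mult (K := R_AbsRing) f h u df dh Hf Hh Rmult_comm).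
Qed.

Lemma is_derive_xi (u : R) : 0 <= u <= 1 -> is_derive xi u (- 2 / (1 + u) ^ 2).
Proof. intros H. unfold xi. auto_derive; [lra|]. field. lra. Qed.

Lemma J_cont (n m : nat) (u : R) : 0 <= u <= 1 ->
  continuous (fun u => u ^ (2 * n) * xi u ^ m) u.
Proof.
  intros H. apply continuous_Rmult; apply continuous_Rpow;
    [apply continuous_id|now apply xi_cont].
Qed.

Lemma J_ex (n m : nat) : ex_RInt (fun u => u ^ (2 * n) * xi u ^ m) 0 1.
Proof. apply ex_RInt_01. intros u Hu. now apply J_cont. Qed.

Lemma J_is (n m : nat) : is_RInt (fun u => u ^ (2 * n) * xi u ^ m) 0 1 (J n m).
Proof. apply (RInt_correct (V := R_CompleteNormedModule)), J_ex. Qed.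

Lemma J_nonneg (n m : nat) : 0 <= J n m.
Proof.
  apply RInt_ge_0; [lra|apply J_ex|]. intros u Hu.
  apply Rmult_le_pos; apply pow_le; [lra|]. apply xi_bounds. lra.
Qed.

Lemma J_le (n m : nat) : J n m <= / (INR m + 1).
Proof.
  rewrite <- (is_RInt_unique _ _ _ _ (is_RInt_pow_compl m)).
  apply RInt_le; [lra|apply J_ex|eexists; apply is_RInt_pow_compl|].
  intros u Hu. assert (Hu' : 0 <= u <= 1) by lra.
  assert (H := pow_01 u (2 * n) Hu'). assert (K := xi_bounds u Hu').
  assert (L := pow_incr (xi u) (1 - u) m K).
  assert (0 <= xi u ^ m) by (apply pow_le; lra). nra.
Qed.

(** Integration by parts: the derivative of xi is -2 / (1 + u)^2, and
    1 - xi^2 = 4u / (1 + u)^2. *)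
Lemma J_rec (n k : nat) :
  J n k - J n (S (S k)) = 2 * oddR n / INR (S k) * J n (S k).
Proof.
  assert (Hk : 0 < INR (S k)) by (apply lt_0_INR; lia).
  assert (D : is_RInt (fun u => oddR n * (u ^ (2 * n) * xi u ^ S k)
      - INR (S k) / 2 * (u ^ (2 * n) * xi u ^ k - u ^ (2 * n) * xi u ^ S (S k))) 0 1 0).
  { apply (is_RInt_derive_01 (fun u => u ^ S (2 * n) * xi u ^ S k)).
    - intros u Hu.
      apply (is_derive_eq _ _ _ _ (is_derive_Rmult _ _ u _ _
               (is_derive_pow _ (S (2 * n)) u 1 (is_derive_id u))
               (is_derive_pow _ (S k) u _ (is_derive_xi u Hu)))).
      change (pred (S (2 * n))) with (2 * n)%nat. change (pred (S k)) with k.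
      replace (INR (S (2 * n))) with (oddR n) by (rewrite oddR_INR; f_equal; lia).
      unfold xi. rewrite <- !tech_pow_Rmult. unfold Rdiv. field. lra.
    - intros u Hu. apply (continuous_minus (V := R_NormedModule)).
      + apply continuous_Rmult; [apply continuous_const|]. now apply J_cont.
      + apply continuous_Rmult; [apply continuous_const|].
        apply (continuous_minus (V := R_NormedModule)); now apply J_cont.
    - unfold xi. rewrite (pow_ne_zero (S (2 * n))) by discriminate. unfold Rdiv.
      rewrite Rminus_diag, Rmult_0_l, (pow_ne_zero (S k)) by discriminate. ring. }
  assert (Q := is_RInt_minus (V := R_NormedModule) _ _ _ _ _ _
    (is_RInt_scal (V := R_NormedModule) _ _ _ (oddR n) _ (J_is n (S k)))
    (is_RInt_scal (V := R_NormedModule) _ _ _ (INR (S k) / 2) _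
      (is_RInt_minus (V := R_NormedModule) _ _ _ _ _ _ (J_is n k) (J_is n (S (S k)))))).
  apply (is_RInt_unique (V := R_CompleteNormedModule)) in D, Q.
  assert (E := eq_trans (eq_sym D) Q).
  change (0 = oddR n * J n (S k) - INR (S k) / 2 * (J n k - J n (S (S k)))) in E.
  apply Rmult_eq_reg_l with (INR (S k) / 2); [|lra].
  replace (INR (S k) / 2 * (2 * oddR n / INR (S k) * J n (S k))) with (oddR n * J n (S k)) by (field; lra).
  lra.
Qed.

(** The sum of the u^(2n) is 1 / (1 - u^2), and xi^m / (1 - u^2) is up to a
    constant factor the derivative of xi^m. *)
Lemma J_sum (m : nat) : is_series (fun n => J n (S m)) (/ (2 * INR (S m))).
Proof.
  assert (Hm : 0 < INR (S m)) by (apply lt_0_INR; lia).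
  set (F := fun u => (1 - u) ^ m / (1 + u) ^ S (S m)).
  assert (Hc : forall u, 0 <= u <= 1 -> (1 + u) ^ S (S m) <> 0).
  { intros u Hu. apply pow_nonzero. lra. }
  assert (HF : forall u, 0 <= u <= 1 -> continuous F u).
  { intros u Hu. apply continuous_Rmult.
    - apply continuous_Rpow. cont.
    - apply continuous_comp; [apply continuous_Rpow; cont|].
      apply continuous_Rinv. apply (Hc u Hu). }
  assert (I : is_RInt F 0 1 (/ (2 * INR (S m)))).
  { apply (is_RInt_derive_01 (fun u => - xi u ^ S m / (2 * INR (S m)))); trivial.
    - intros u Hu.
      assert (H := is_derive_scal _ u (- / (2 * INR (S m))) _ (is_derive_pow _ (S m) u _ (is_derive_xi u Hu))).
      apply (is_derive_ext (fun u => - / (2 * INR (S m)) * xi u ^ S m)).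
      { intros t. unfold Rdiv. rewrite <- Ropp_mult_distr_l, Rmult_comm. apply Ropp_mult_distr_l. }
      apply (is_derive_eq _ _ _ _ H).
      change (pred (S m)) with m. unfold F, xi.
      unfold Rdiv. rewrite !Rpow_mult_distr, pow_inv. simpl pow. field.
      repeat split; try lra. apply pow_nonzero. lra.
    - unfold xi, Rdiv. rewrite Rminus_diag, Rmult_0_l, pow_ne_zero by discriminate.
      replace ((1 - 0) * / (1 + 0)) with 1 by field. rewrite pow1. field. lra. }
  rewrite <- (is_RInt_unique _ _ _ _ I).
  apply (is_series_eq (fun j => RInt (fun u => F u * (1 - u ^ 2) * (u ^ 2) ^ j) 0 1) _ (RInt F 0 1)); trivial.
  - apply (is_series_RInt_geom _ (fun u => u ^ 2) (fun u => u) 1); trivial; try exact is_RInt_pow.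
    + intros u Hu. cont.
    + intros u Hu. apply bound_inv_one.
      * apply pow_01. lra.
      * apply pow_R1_Rle. lra.
    + intros u Hu. rewrite Rabs_pos_eq; nra.
  - intros n. apply RInt_ext_01. intros u Hu. unfold F, xi, Rdiv.
    rewrite Rpow_mult_distr, pow_inv, <- pow_mult. simpl (_ ^ S _). field.
    split; [apply pow_nonzero|]; lra.
Qed.

(** The innermost sum of the multiple series, over the m of the parity opposite to
    that of [e], after [J_rec]: it is a geometric series of ratio - xi^2. *)
Lemma J_alternating_sum (n e : nat) :
  is_series (fun k => (-1) ^ (k + 1) * (J n (2 * k + e) - J n (2 * k + e + 2)))
    (- RInt (fun u => u ^ (2 * n) * (xi u ^ e * (1 - xi u ^ 2) / (1 + xi u ^ 2))) 0 1).
Proof.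
  set (F := fun u => u ^ (2 * n) * (xi u ^ e * (1 - xi u ^ 2) / (1 + xi u ^ 2))).
  assert (cF : forall u, 0 <= u <= 1 -> continuous F u).
  { intros u Hu. unfold F, xi. cont. intros H.
    assert (0 <= ((1 - u) * / (1 + u)) ^ 2) by apply pow2_ge_0. lra. }
  assert (cq : forall u, 0 <= u <= 1 -> continuous (fun u => - xi u ^ 2) u).
  { intros u Hu. unfold xi. cont. }
  apply (is_series_eq (fun k => - 1 * RInt (fun u => F u * (1 - - xi u ^ 2) * (- xi u ^ 2) ^ k) 0 1) _ (- 1 * RInt F 0 1)).
  - apply is_series_Rscal.
    apply (is_series_RInt_geom _ (fun u => - xi u ^ 2) (fun u => 1 - u) 1);
      trivial; try exact is_RInt_pow_compl.
    + intros u Hu. unfold F. assert (H := pow_01 u (2 * n) Hu). assert (K := xi_bounds u Hu).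
      assert (L := pow_01 (xi u) e ltac:(lra)).
      rewrite Rabs_mult. apply Rle_trans with (1 * 1); [|lra].
      apply Rmult_le_compat; try apply Rabs_pos.
      * rewrite Rabs_pos_eq; lra.
      * apply bound_inv_one; [|nra]. assert (0 <= 1 - xi u ^ 2 <= 1) by nra. nra.
    + intros u Hu. assert (K := xi_bounds u Hu). rewrite Rabs_Ropp, Rabs_pos_eq; nra.
  - intros k. unfold J. rewrite <- RInt_Rminus_01 by apply J_ex.
    rewrite <- RInt_Rscal_01, <- RInt_Rscal_01.
    + apply RInt_ext_01. intros u Hu. unfold F.
      assert (K := xi_bounds u Hu).
      replace (- xi u ^ 2) with (-1 * xi u ^ 2) at 2 by ring.
      rewrite Rpow_mult_distr, <- (pow_mult (xi u)), !(pow_add (xi u)), pow_add. field. nra.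
    + apply (ex_RInt_minus (V := R_NormedModule)); apply J_ex.
    + apply ex_RInt_01. intros u Hu. apply continuous_Rmult.
      * apply continuous_Rmult; auto.
        apply (continuous_minus (V := R_NormedModule)); [apply continuous_const|auto].
      * now apply continuous_Rpow, cq.
  - ring.
Qed.

Lemma J_odd_sum (n : nat) :
  is_series (fun k => (-1) ^ (k + 1) * (J n (2 * k) - J n (2 * k + 2))) (- 2 * psi (2 * n + 1)).
Proof.
  apply (is_series_eq _ _ _ _ (J_alternating_sum n 0)).
  - intros k. now rewrite Nat.add_0_r.
  - replace (-2 * psi (2 * n + 1)) with (- (2 * psi (2 * n + 1))) by ring.
    unfold psi. f_equal. rewrite <- RInt_Rscal_01.
    + apply RInt_ext_01. intros u Hu. unfold xi. rewrite pow_add. field. nra.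
    + apply ex_RInt_01. intros u Hu. cont.
Qed.

Lemma J_even_sum (n : nat) :
  is_series (fun k => (-1) ^ (k + 1) * (J n (2 * k + 1) - J n (2 * k + 3))) (- 2 * phi (2 * n + 1)).
Proof.
  apply (is_series_eq _ _ _ _ (J_alternating_sum n 1)).
  - intros k. now rewrite <- Nat.add_assoc.
  - replace (-2 * phi (2 * n + 1)) with (- (2 * phi (2 * n + 1))) by ring.
    unfold phi. f_equal. rewrite <- RInt_Rscal_01.
    + apply RInt_ext_01. intros u Hu. unfold xi. rewrite pow_add. field. nra.
    + apply ex_RInt_01. intros u Hu. cont.
Qed.

(** * Duality: the multiple values as single sums *)

(** The sums of [mixed_sum] start at 1; for an upper bound 0 they are empty. *)
Lemma sum_1_S (f : nat -> R) (M : nat) :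
  sum_n_m f 1 (S M) = sum_n_m f 1 M + f (S M).
Proof. exact (sum_n_Sm f 1 M ltac:(lia)). Qed.

Lemma sum_1_0 (f : nat -> R) : sum_n_m f 1 0 = 0.
Proof. exact (sum_n_m_zero f 1 0 ltac:(lia)). Qed.

Lemma sum_1_sum_n (f : nat -> R) (M : nat) :
  sum_n_m f 1 (S M) = sum_n (fun m => f (S m)) M.
Proof. symmetry. exact (sum_n_m_S f 0 M). Qed.

Lemma pow_m1_even (k : nat) : (-1) ^ (2 * k) = 1.
Proof. rewrite pow_mult. replace ((-1) ^ 2) with 1 by ring. apply pow1. Qed.

Lemma pow_m1_odd (k : nat) : (-1) ^ (2 * k + 1) = -1.
Proof. rewrite pow_add, pow_m1_even. ring. Qed.

(** For sigma = 1 the power of sigma disappears: its exponent is never negative, so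
    that the convention for negative exponents in Z plays no role. *)
Lemma mixed_factor_Plus (e : sign) (s m : nat) :
  mixed_factor e Plus s m = (1 + IZR (sgn e) * (-1) ^ m) / INR m ^ s.
Proof.
  unfold mixed_factor, Rdiv. simpl (sgn Plus).
  destruct (Z.le_gt_cases 0 ((2 * Z.of_nat m + 1 - sgn e) / 4)) as [H|H].
  - rewrite Z.pow_1_l by trivial. ring.
  - exfalso. assert (0 <= (2 * Z.of_nat m + 1 - sgn e) / 4)%Z; [|lia].
    apply Z.div_pos; [destruct e; unfold sgn; lia|lia].
Qed.

(** The parity that the sign [e] imposes on a summation variable. *)
Definition parity (e : sign) (m : nat) : Prop :=
  match e with Plus => Nat.Even m | Minus => Nat.Odd m end.

Lemma parity_dec (e : sign) (m : nat) :
  parity e m /\ ~ parity e (S m) /\ (-1) ^ m = IZR (sgn e) \/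
  ~ parity e m /\ parity e (S m) /\ (-1) ^ m = - IZR (sgn e).
Proof.
  destruct (Nat.Even_or_Odd m) as [[k ->]|[k ->]];
    rewrite ?pow_m1_even, ?pow_m1_odd;
    [destruct e; [left|right]|destruct e; [right|left]]; simpl;
    (split; [|split]); try lra;
    try (intros [i Hi]; lia); try (exists k; lia); try (exists (S k); lia).
Qed.

Lemma mixed_factor_wrong_parity (e s : sign) (k m : nat) :
  ~ parity e m -> mixed_factor e s k m = 0.
Proof.
  intros H. destruct (parity_dec e m) as [(H1 & _)|(_ & _ & E)]; [easy|].
  unfold mixed_factor. rewrite E.
  replace (1 + IZR (sgn e) * - IZR (sgn e)) with 0; [unfold Rdiv; ring|].
  destruct e; simpl; ring.
Qed.

Lemma mixed_factor_Plus_parity (e : sign) (s m : nat) :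
  parity e m -> mixed_factor e Plus s m = 2 / INR m ^ s.
Proof.
  intros H. destruct (parity_dec e m) as [(_ & _ & E)|(H1 & _)]; [|easy].
  rewrite mixed_factor_Plus, E. destruct e; simpl; f_equal; ring.
Qed.

Lemma IZR_sgn_pow (s : sign) (k : Z) : Rabs (IZR (sgn s ^ k)) <= 1.
Proof.
  destruct (Z.le_gt_cases 0 k) as [H|H].
  - rewrite <- (Z2Nat.id k H), <- pow_IZR, <- RPow_abs.
    destruct s; simpl; rewrite ?Rabs_m1, ?Rabs_R1, pow1; lra.
  - rewrite Z.pow_neg_r by trivial. rewrite Rabs_R0. lra.
Qed.

Lemma mixed_factor_bound (e s : sign) (m : nat) :
  Rabs (mixed_factor e s 1 (S m)) <= 2 / (INR m + 1).
Proof.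
  unfold mixed_factor, Rdiv. rewrite pow_1, S_INR. assert (Hm := pos_INR m).
  rewrite !Rabs_mult, (Rabs_pos_eq (/ (INR m + 1)))
    by (apply Rlt_le, Rinv_0_lt_compat; lra).
  apply Rmult_le_compat_r; [apply Rlt_le, Rinv_0_lt_compat; lra|].
  replace 2 with (2 * 1) by ring. apply Rmult_le_compat; try apply Rabs_pos.
  - destruct (parity_dec e (S m)) as [(_ & _ & E)|(_ & _ & E)]; rewrite E;
      destruct e; simpl; apply Rabs_le; lra.
  - apply IZR_sgn_pow.
Qed.

(** The index lists whose entries s_j are all equal to 1. *)
Definition all_ones (l : list (sign * sign * nat)) : Prop :=
  List.Forall (fun x => snd x = 1%nat) l.

(** A crude bound: these sums grow at most like a power of log M. *)
Lemma mixed_sum_bound (l : list (sign * sign * nat)) : all_ones l ->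
  exists C, 0 <= C /\ forall M, Rabs (mixed_sum l M) <= C * sqrt (INR M + 1).
Proof.
  induction 1 as [|[[e s] k] l Hk _ (C & HC & IH)].
  - exists 1. split; [lra|]. intros M. simpl. rewrite Rabs_R1, Rmult_1_l.
    rewrite <- sqrt_1 at 1. apply sqrt_le_1_alt. generalize (pos_INR M). lra.
  - simpl in Hk. subst k. exists (4 * C). split; [lra|]. intros M.
    simpl mixed_sum.
    apply Rle_trans with (4 * C * sqrt (INR M)).
    2: { apply Rmult_le_compat_l; [lra|]. apply sqrt_le_1_alt. lra. }
    induction M as [|M IHM].
    + rewrite sum_1_0, Rabs_R0. simpl. rewrite sqrt_0. lra.
    + rewrite sum_1_S. replace (S M - 1)%nat with M by lia.
      apply Rle_trans with (1 := Rabs_triang _ _). rewrite Rabs_mult.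
      assert (Hm := pos_INR M). rewrite S_INR.
      assert (Ha := sqrt_pos (INR M)). assert (Hb := sqrt_lt_R0 (INR M + 1) ltac:(lra)).
      assert (Ea := sqrt_sqrt (INR M) ltac:(lra)). assert (Eb := sqrt_sqrt (INR M + 1) ltac:(lra)).
      assert (K : Rabs (mixed_factor e s 1 (S M)) * Rabs (mixed_sum l M)
                  <= 2 / (INR M + 1) * (C * sqrt (INR M + 1))).
      { apply Rmult_le_compat; try apply Rabs_pos; [apply mixed_factor_bound|apply IH]. }
      rewrite <- Eb in K at 1.
      set (a := sqrt (INR M)) in *. set (b := sqrt (INR M + 1)) in *.
      replace (2 / (b * b) * (C * b)) with (C * (2 / b)) in K by (field; lra).
      assert (2 / b <= 4 * (b - a)).
      { apply Rmult_le_reg_r with b; trivial. unfold Rdiv.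
        rewrite Rmult_assoc, Rinv_l by lra. nra. }
      assert (C * (2 / b) <= C * (4 * (b - a))) by (apply Rmult_le_compat_l; lra).
      lra.
Qed.

(** The partial sums of the series in [mixed_sum] whose outermost variable m carries
    the additional factor J(n, m). The value at the empty list is irrelevant. *)
Definition J_sums (n : nat) (l : list (sign * sign * nat)) (M : nat) : R :=
  match l with
  | [] => 0
  | (e, s, k) :: l' =>
      sum_n_m (fun m => mixed_factor e s k m * mixed_sum l' (m - 1) * J n m) 1 M
  end.

Lemma J_decay (n : nat) (u : nat -> R) (C : R) : 0 <= C ->
  (forall M, Rabs (u M) <= C * sqrt (INR M + 1)) ->
  is_lim_seq (fun M => J n M * u M) 0.
Proof.
  intros HC Hu. apply is_lim_seq_abs_0.
  apply (is_lim_seq_le_le (fun _ => 0) _ (fun M => C * sqrt (/ (1 * INR M + 1)))).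
  - intros M. split; [apply Rabs_pos|]. assert (HM := pos_INR M).
    rewrite Rabs_mult, (Rabs_pos_eq (J n M)) by apply J_nonneg.
    apply Rle_trans with (/ (INR M + 1) * (C * sqrt (INR M + 1))).
    + apply Rmult_le_compat; trivial; [apply J_nonneg|apply Rabs_pos|apply J_le].
    + rewrite Rmult_1_l, sqrt_inv.
      assert (Hb := sqrt_lt_R0 (INR M + 1) ltac:(lra)).
      rewrite <- (sqrt_sqrt (INR M + 1)) at 1 by lra.
      apply Req_le. field. lra.
  - apply is_lim_seq_const.
  - replace (Finite 0) with (Rbar_mult C (sqrt 0)) by (rewrite sqrt_0; simpl; f_equal; ring).
    apply is_lim_seq_scal_l. apply (is_lim_seq_continuous sqrt _ 0).
    + apply continuity_pt_sqrt. lra.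
    + apply is_lim_seq_inv_linear. lra.
Qed.

Lemma J_decay_S (n : nat) (u : nat -> R) (C : R) : 0 <= C ->
  (forall M, Rabs (u M) <= C * sqrt (INR M + 1)) ->
  is_lim_seq (fun M => J n (S M) * u M) 0.
Proof.
  intros HC Hu.
  apply (is_lim_seq_incr_1 (fun M => J n M * u (pred M))).
  apply (J_decay n (fun M => u (pred M)) C HC).
  intros M. apply Rle_trans with (1 := Hu _). apply Rmult_le_compat_l; trivial.
  apply sqrt_le_1_alt. generalize (le_INR _ _ (Nat.le_pred_l M)). lra.
Qed.

(** One step of the chain of sums: by Abel summation, the relation between
    J(n, m - 1), J(n, m) and J(n, m + 1) removes the outermost variable and
    leaves a factor 1 / (2n + 1). *)
Lemma J_sums_step (n : nat) (e s : sign) (l : list (sign * sign * nat)) (x : R) :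
  all_ones ((sign_opp e, s, 1%nat) :: l) ->
  is_lim_seq (J_sums n ((sign_opp e, s, 1%nat) :: l)) x ->
  is_lim_seq (J_sums n ((e, Plus, 1%nat) :: (sign_opp e, s, 1%nat) :: l)) (x / oddR n).
Proof.
  intros Hl Hx.
  set (a := fun m => mixed_factor (sign_opp e) s 1 m * mixed_sum l (m - 1)) in *.
  set (G := fun M => sum_n_m a 1 M).
  assert (HX := oddR_ge1 n).
  assert (HA : forall m, parity e m -> a m = 0).
  { intros m Hm. unfold a. rewrite mixed_factor_wrong_parity; [ring|].
    destruct (Nat.Even_or_Odd m) as [[k ->]|[k ->]]; destruct e; simpl in *;
      intros [i Hi]; destruct Hm; lia. }
  destruct (mixed_sum_bound _ Hl) as (C & HC & HG).
  change (forall M, Rabs (G M) <= C * sqrt (INR M + 1)) in HG.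
  (* B is the boundary term of the Abel summation. Its form depends on the parity
     of M: the condition tests whether M has the parity e. *)
  set (B := fun M => if Rlt_dec 0 (IZR (sgn e) * (-1) ^ M)
                     then J n (S M) * G M else J n M * G M).
  assert (HB : is_lim_seq B 0).
  { apply is_lim_seq_abs_0.
    apply (is_lim_seq_le_le (fun _ => 0) _ (fun M => Rabs (J n (S M) * G M) + Rabs (J n M * G M))).
    - intros M. split; [apply Rabs_pos|]. unfold B.
      generalize (Rabs_pos (J n (S M) * G M)) (Rabs_pos (J n M * G M)).
      destruct (Rlt_dec _ _); lra.
    - apply is_lim_seq_const.
    - replace (Finite 0) with (Finite (0 + 0)) by (f_equal; ring).
      apply is_lim_seq_plus'; apply -> is_lim_seq_abs_0; [eapply J_decay_S|eapply J_decay]; eauto. }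
  apply (is_lim_seq_ext (fun M => / oddR n * (sum_n_m (fun m => a m * J n m) 1 M - B M))).
  - intros M. simpl J_sums. simpl mixed_sum. fold a.
    induction M as [|M IH].
    + rewrite !sum_1_0. unfold B, G. rewrite sum_1_0. destruct (Rlt_dec _ _); ring.
    + rewrite !sum_1_S, <- IH. replace (S M - 1)%nat with M by lia.
      fold (G M). unfold B at 1 2.
      assert (EG : G (S M) = G M + a (S M)) by apply sum_1_S. rewrite EG.
      assert (Hs : IZR (sgn e) * IZR (sgn e) = 1) by (destruct e; simpl; ring).
      rewrite <- tech_pow_Rmult.
      destruct (parity_dec e M) as [(P & Q & E)|(P & Q & E)]; rewrite E.
      * rewrite (mixed_factor_wrong_parity e Plus 1 (S M) Q).
        destruct (Rlt_dec 0 (IZR (sgn e) * (-1 * IZR (sgn e)))); [lra|].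
        destruct (Rlt_dec 0 (IZR (sgn e) * IZR (sgn e))); [|lra].
        ring.
      * rewrite (mixed_factor_Plus_parity e 1 (S M) Q), (HA (S M) Q).
        destruct (Rlt_dec 0 (IZR (sgn e) * (-1 * - IZR (sgn e)))); [|lra].
        destruct (Rlt_dec 0 (IZR (sgn e) * - IZR (sgn e))); [lra|].
        assert (HJ := J_rec n M).
        assert (0 < INR (S M)) by (apply lt_0_INR; lia).
        replace (2 / INR (S M) ^ 1 * G M * J n (S M)) with
          (/ oddR n * (2 * oddR n / INR (S M) * J n (S M)) * G M) by (field; lra).
        rewrite <- HJ. ring.
  - replace (Finite (x / oddR n)) with (Rbar_mult (/ oddR n) (x - 0)) by (simpl; f_equal; field; lra).
    apply is_lim_seq_scal_l. apply is_lim_seq_minus'; trivial.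
Qed.

Lemma sgn_Minus_pow (k : nat) : IZR (sgn Minus ^ Z.of_nat k) = (-1) ^ k.
Proof. symmetry. apply pow_IZR. Qed.

Lemma mixed_factor_ev_Minus (s k : nat) :
  mixed_factor ev Minus s (2 * k) = 2 * (-1) ^ k / INR (2 * k) ^ s.
Proof.
  unfold mixed_factor. rewrite pow_m1_even, <- sgn_Minus_pow.
  replace ((2 * Z.of_nat (2 * k) + 1 - sgn ev) / 4)%Z with (Z.of_nat k).
  - simpl (IZR (sgn ev)). f_equal. ring.
  - simpl (sgn ev). apply Z.div_unique with 0%Z; lia.
Qed.

Lemma mixed_factor_od_Minus (s k : nat) :
  mixed_factor od Minus s (2 * k + 1) = 2 * (-1) ^ (k + 1) / INR (2 * k + 1) ^ s.
Proof.
  unfold mixed_factor. rewrite pow_m1_odd, <- sgn_Minus_pow.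
  replace ((2 * Z.of_nat (2 * k + 1) + 1 - sgn od) / 4)%Z with (Z.of_nat (k + 1)).
  - simpl (IZR (sgn od)). f_equal. ring.
  - simpl (sgn od). apply Z.div_unique with 0%Z; lia.
Qed.

Lemma J_sums_single (n : nat) (e s : sign) (k M : nat) :
  J_sums n [(e, s, k)] M = sum_n_m (fun m => mixed_factor e s k m * J n m) 1 M.
Proof. apply sum_n_m_ext. intros m. simpl mixed_sum. now rewrite Rmult_1_r. Qed.

Lemma J_sums_last_ev (n : nat) :
  is_lim_seq (J_sums n [(ev, Minus, 1%nat)]) (- 2 * phi (2 * n + 1) / oddR n).
Proof.
  assert (HX := oddR_ge1 n).
  assert (HS := is_series_Rscal (/ oddR n) _ _ (J_even_sum n)).
  replace (- 2 * phi (2 * n + 1) / oddR n) with (/ oddR n * (- 2 * phi (2 * n + 1))) by (field; lra).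
  assert (E : forall K, J_sums n [(ev, Minus, 1%nat)] (2 * K + 2) =
    sum_n (fun k => / oddR n * ((-1) ^ (k + 1) * (J n (2 * k + 1) - J n (2 * k + 3)))) K).
  { assert (T : forall k, mixed_factor ev Minus 1 (2 * k + 2) * J n (2 * k + 2) =
      / oddR n * ((-1) ^ (k + 1) * (J n (2 * k + 1) - J n (2 * k + 3)))).
    { intros k. replace (2 * k + 3)%nat with (S (S (2 * k + 1))) by lia. rewrite J_rec.
      replace (S (2 * k + 1)) with (2 * (k + 1))%nat by lia.
      replace (2 * k + 2)%nat with (2 * (k + 1))%nat by lia.
      rewrite mixed_factor_ev_Minus.
      assert (0 < INR (2 * (k + 1))) by (apply lt_0_INR; lia). field. lra. }
    assert (Z : forall k, mixed_factor ev Minus 1 (2 * k + 1) = 0).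
    { intros k. apply mixed_factor_wrong_parity. simpl. intros [i Hi]. lia. }
    intros K. rewrite J_sums_single.
    induction K as [|K IH].
    - rewrite sum_O, <- T. change (2 * 0 + 2)%nat with 2%nat. rewrite !sum_1_S, sum_1_0.
      change 1%nat with (2 * 0 + 1)%nat at 2. rewrite (Z O). ring.
    - rewrite sum_n_S, <- IH, <- T. replace (2 * S K + 2)%nat with (S (S (2 * K + 2))) by lia.
      rewrite !sum_1_S. replace (S (2 * K + 2)) with (2 * (K + 1) + 1)%nat by lia.
      rewrite Z. ring. }
  apply is_lim_seq_even_odd; apply is_lim_seq_incr_1.
  - apply (is_lim_seq_ext (fun K => sum_n (fun k => / oddR n * ((-1) ^ (k + 1) * (J n (2 * k + 1) - J n (2 * k + 3)))) K)).
    + intros K. rewrite <- E. f_equal. lia.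
    + exact HS.
  - apply (is_lim_seq_ext (fun K => sum_n (fun k => / oddR n * ((-1) ^ (k + 1) * (J n (2 * k + 1) - J n (2 * k + 3)))) K)).
    + intros K. rewrite <- E, !J_sums_single.
      replace (2 * S K + 1)%nat with (S (2 * K + 2)) by lia. rewrite sum_1_S.
      rewrite (mixed_factor_wrong_parity ev Minus 1 (S (2 * K + 2))); [now rewrite Rmult_0_l, Rplus_0_r|].
      simpl. intros [i Hi]. lia.
    + exact HS.
Qed.

Lemma J_sums_last_od (n : nat) :
  is_lim_seq (J_sums n [(od, Minus, 1%nat)]) (- 2 * psi (2 * n + 1) / oddR n).
Proof.
  assert (HX := oddR_ge1 n).
  assert (HS := is_series_Rscal (/ oddR n) _ _ (J_odd_sum n)).
  replace (- 2 * psi (2 * n + 1) / oddR n) with (/ oddR n * (- 2 * psi (2 * n + 1))) by (field; lra).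
  assert (E : forall K, J_sums n [(od, Minus, 1%nat)] (2 * K + 1) =
    sum_n (fun k => / oddR n * ((-1) ^ (k + 1) * (J n (2 * k) - J n (2 * k + 2)))) K).
  { assert (T : forall k, mixed_factor od Minus 1 (2 * k + 1) * J n (2 * k + 1) =
      / oddR n * ((-1) ^ (k + 1) * (J n (2 * k) - J n (2 * k + 2)))).
    { intros k. replace (2 * k + 2)%nat with (S (S (2 * k))) by lia. rewrite J_rec.
      replace (S (2 * k)) with (2 * k + 1)%nat by lia.
      rewrite mixed_factor_od_Minus.
      assert (0 < INR (2 * k + 1)) by (apply lt_0_INR; lia). field. lra. }
    assert (Z : forall k, mixed_factor od Minus 1 (2 * k) = 0).
    { intros k. apply mixed_factor_wrong_parity. simpl. intros [i Hi]. lia. }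
    intros K. rewrite J_sums_single.
    induction K as [|K IH].
    - rewrite sum_O, <- T. change (2 * 0 + 1)%nat with 1%nat. rewrite !sum_1_S, sum_1_0. ring.
    - rewrite sum_n_S, <- IH, <- T. replace (2 * S K + 1)%nat with (S (S (2 * K + 1))) by lia.
      rewrite !sum_1_S. replace (S (2 * K + 1)) with (2 * (K + 1))%nat by lia.
      rewrite Z. ring. }
  apply is_lim_seq_even_odd.
  - apply is_lim_seq_incr_1.
    apply (is_lim_seq_ext (fun K => sum_n (fun k => / oddR n * ((-1) ^ (k + 1) * (J n (2 * k) - J n (2 * k + 2)))) K)).
    + intros K. rewrite <- E, !J_sums_single.
      replace (2 * S K)%nat with (S (2 * K + 1)) by lia. rewrite sum_1_S.
      rewrite (mixed_factor_wrong_parity od Minus 1 (S (2 * K + 1))); [now rewrite Rmult_0_l, Rplus_0_r|].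
      simpl. intros [i Hi]. lia.
    + exact HS.
  - apply (is_lim_seq_ext (fun K => sum_n (fun k => / oddR n * ((-1) ^ (k + 1) * (J n (2 * k) - J n (2 * k + 2)))) K)).
    + intros K. now rewrite <- E.
    + exact HS.
Qed.

(** The integral to which the innermost sum leads, according to its parity. *)
Definition last_value (e : sign) (n : nat) : R :=
  match e with Plus => phi (2 * n + 1) | Minus => psi (2 * n + 1) end.

(** The indices 1, ..., 1 with r ones, followed by a barred 1. *)
Definition ones (r : nat) : list (sign * nat) := repeat (unbarred 1) r ++ [barred 1].

Lemma ones_length (r : nat) : length (ones r) = S r.
Proof. unfold ones. rewrite length_app, repeat_length. simpl. lia. Qed.

Lemma all_ones_alternate (e : sign) (r : nat) : all_ones (alternate e (ones r)).
Proof.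
  induction r as [|r IH].
  - repeat constructor.
  - constructor; [reflexivity|exact IH].
Qed.

(** The parity of the outermost variable in an alternating list of length r + 1
    whose innermost parity is [e]. *)
Definition outer_parity (e : sign) (r : nat) : sign :=
  if Nat.even r then e else sign_opp e.

Lemma outer_parity_S (e : sign) (r : nat) :
  outer_parity e r = sign_opp (outer_parity e (S r)).
Proof.
  unfold outer_parity. rewrite Nat.even_succ, <- Nat.negb_even.
  destruct (Nat.even r), e; reflexivity.
Qed.

Lemma alternate_ones_S (e : sign) (r : nat) :
  alternate e (ones (S r)) = (outer_parity e (S r), Plus, 1%nat) :: alternate e (ones r).
Proof.
  change (ones (S r)) with (unbarred 1 :: ones r). unfold outer_parity.
  cbn [alternate unbarred]. now rewrite ones_length.
Qed.

Lemma alternate_ones_head (e : sign) (r : nat) :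
  exists s l, alternate e (ones r) = (outer_parity e r, s, 1%nat) :: l.
Proof.
  destruct r as [|r].
  - now exists Minus, [].
  - rewrite alternate_ones_S. eauto.
Qed.

Lemma J_sums_ones (n : nat) (e : sign) (r : nat) :
  is_lim_seq (J_sums n (alternate e (ones r))) (- 2 * last_value e n / oddR n ^ S r).
Proof.
  assert (HX := oddR_ge1 n).
  induction r as [|r IH].
  - rewrite pow_1. destruct e; [apply J_sums_last_ev|apply J_sums_last_od].
  - rewrite alternate_ones_S.
    replace (-2 * last_value e n / oddR n ^ S (S r)) with (-2 * last_value e n / oddR n ^ S r / oddR n).
    + assert (H1 := all_ones_alternate e r).
      destruct (alternate_ones_head e r) as (s & l & E). rewrite E in *.
      rewrite (outer_parity_S e r) in *. now apply J_sums_step.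
    + simpl. field. repeat split; [apply pow_nonzero|]; lra.
Qed.

(** One of the two factors 1 / m of the outermost variable is written as
    2 sum_n J(n, m), and the sums are exchanged. The outermost variable is
    odd, as in the values of E and F. *)
Lemma mixed_value_duality (e : sign) (r : nat) :
  outer_parity e (S r) = od ->
  is_series (fun n => - 4 * last_value e n / oddR n ^ S (S r))
    (mixed_value ((od, Plus, 2%nat) :: alternate e (ones r))).
Proof.
  intros Ho.
  destruct (mixed_sum_bound _ (all_ones_alternate e r)) as (C & HC & HG).
  set (G := mixed_sum (alternate e (ones r))) in *.
  set (f := mixed_factor od Plus 1).
  set (a := fun m n => 2 * (f (S m) * G m * J n (S m))).
  assert (Hrow : forall m c, is_series (fun n => c * J n (S m)) (c / (2 * INR (S m)))).
  { intros m c. exact (is_series_Rscal c _ _ (J_sum m)). }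
  assert (Habs : forall m, is_series (fun n => Rabs (a m n))
            (Rabs (2 * (f (S m) * G m)) / (2 * INR (S m)))).
  { intros m. apply (is_series_eq _ _ _ _ (Hrow m (Rabs (2 * (f (S m) * G m))))); trivial.
    intros n. unfold a. rewrite <- (Rabs_pos_eq (J n (S m))) at 1 by apply J_nonneg.
    rewrite <- Rabs_mult. f_equal. ring. }
  assert (Hsum : ex_series (fun m => Series (fun n => Rabs (a m n)))).
  { apply (ex_series_le_R _ (fun m => 2 * C * / ((INR m + 1) * sqrt (INR m + 1)))).
    - intros m. rewrite (is_series_unique _ _ (Habs m)), S_INR. assert (Hm := pos_INR m).
      rewrite Rabs_pos_eq.
      2: { apply Rmult_le_pos; [apply Rabs_pos|]. apply Rlt_le, Rinv_0_lt_compat. lra. }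
      rewrite Rabs_mult, (Rabs_pos_eq 2), Rabs_mult by lra.
      assert (Hb := sqrt_lt_R0 (INR m + 1) ltac:(lra)).
      assert (Eb := sqrt_sqrt (INR m + 1) ltac:(lra)).
      assert (K : Rabs (f (S m)) * Rabs (G m) <= 2 / (INR m + 1) * (C * sqrt (INR m + 1))).
      { apply Rmult_le_compat; try apply Rabs_pos; [apply mixed_factor_bound|apply HG]. }
      apply Rle_trans with (2 * (2 / (INR m + 1) * (C * sqrt (INR m + 1))) / (2 * (INR m + 1))).
      + apply Rmult_le_compat_r; [|lra]. apply Rlt_le, Rinv_0_lt_compat. lra.
      + apply Req_le. set (b := sqrt (INR m + 1)) in *. rewrite <- Eb. field. lra.
    - destruct ex_series_three_halves as [l Hl]. eexists. apply is_series_Rscal, Hl. }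
  destruct (Fubini_series a (fun m => ex_intro _ _ (Habs m)) Hsum) as (HS & Hc & HF).
  assert (Hcol : forall n, Series (fun m => a m n) = - 4 * last_value e n / oddR n ^ S (S r)).
  { intros n. assert (L := J_sums_ones n e (S r)). rewrite alternate_ones_S, Ho in L.
    apply is_lim_seq_incr_1 in L. apply is_series_unique.
    apply (is_series_eq (fun m => 2 * (f (S m) * G m * J n (S m))) _
             (2 * (- 2 * last_value e n / oddR n ^ S (S r)))); trivial.
    - apply is_series_Rscal. refine (is_lim_seq_ext _ _ _ _ L).
      intros M. unfold J_sums. rewrite sum_1_sum_n. apply sum_n_eq. intros m.
      now replace (S m - 1)%nat with m by lia.
    - unfold Rdiv. ring. }
  apply (is_series_eq _ _ _ _ HF Hcol).
  unfold mixed_value.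
  assert (L : is_lim_seq (mixed_sum ((od, Plus, 2%nat) :: alternate e (ones r)))
                (Series (fun m => Series (a m)))).
  { apply is_lim_seq_incr_1. simpl mixed_sum.
    apply (is_lim_seq_ext (sum_n (fun m => Series (a m)))); [|exact (Series_is _ HS)].
    intros M. rewrite sum_1_sum_n. apply sum_n_eq. intros m.
    replace (S m - 1)%nat with m by lia. fold G.
    assert (0 < INR (S m)) by (apply lt_0_INR; lia).
    transitivity (2 * (f (S m) * G m) / (2 * INR (S m))).
    - apply is_series_unique.
      apply (is_series_eq _ _ _ _ (Hrow m (2 * (f (S m) * G m)))); trivial.
      intros n. unfold a. ring.
    - unfold f. rewrite !mixed_factor_Plus. field. lra. }
  now rewrite (is_lim_seq_unique _ _ L).
Qed.

Lemma S_value_duality (m : nat) :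
  is_series (fun n => - 4 * phi (2 * n + 1) / oddR n ^ (2 * (m + 1)))
    (S_value (unbarred 2 :: repeat (unbarred 1) (2 * m) ++ [barred 1])).
Proof.
  assert (E : Nat.even (2 * m) = true) by (rewrite Nat.even_mul; reflexivity).
  assert (H := mixed_value_duality ev (2 * m)).
  unfold outer_parity in H. rewrite Nat.even_succ, <- Nat.negb_even, E in H.
  specialize (H eq_refl). simpl last_value in H.
  replace (2 * (m + 1))%nat with (S (S (2 * m))) by lia.
  unfold S_value. simpl alternate. change (repeat (unbarred 1) (m + (m + 0))) with (repeat (unbarred 1) (2 * m)).
  fold (ones (2 * m)). rewrite ones_length, Nat.even_succ, <- Nat.negb_even, E. exact H.
Qed.

Lemma T_value_duality (m : nat) :
  is_series (fun n => - 4 * psi (2 * n + 1) / oddR n ^ (2 * m + 3))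
    (T_value (unbarred 2 :: repeat (unbarred 1) (2 * m + 1) ++ [barred 1])).
Proof.
  assert (E : Nat.even (2 * m + 1) = false) by (rewrite Nat.even_add, Nat.even_mul; reflexivity).
  assert (H := mixed_value_duality od (2 * m + 1)).
  unfold outer_parity in H. rewrite Nat.even_succ, <- Nat.negb_even, E in H.
  specialize (H eq_refl). simpl last_value in H.
  replace (2 * m + 3)%nat with (S (S (2 * m + 1))) by lia.
  unfold T_value. fold (ones (2 * m + 1)). cbn [alternate unbarred].
  rewrite ones_length, Nat.even_succ, <- Nat.negb_even, E. exact H.
Qed.

(** * Explicit sums of inverse differences of squares *)

Lemma is_series_inv_telescope (a b : R) : 0 < a ->
  is_series (fun n => / (a * INR n + b) - / (a * INR n + (a + b))) (/ b).
Proof.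
  intros Ha.
  apply (is_series_eq _ _ _ _ (is_series_telescope _ (is_lim_seq_inv_linear a b Ha))).
  - intros n. rewrite S_INR. do 2 f_equal. ring.
  - simpl. f_equal. ring.
Qed.

(** In this and the following sums, the singular term for m = n, if any, is 0, by
    the convention / 0 = 0. *)
Lemma odd_differences_sum (n : nat) :
  is_series (fun m => / (2 * INR m - 2 * INR n) - / (2 * INR m + 2 * (INR n + 1))) 0.
Proof.
  induction n as [|n IH].
  - apply (is_series_eq _ _ _ _ (is_series_inv_telescope 2 0 ltac:(lra))).
    + intros m. simpl. f_equal; [f_equal; ring|]. do 2 f_equal. ring.
    + apply Rinv_0.
  - assert (Hn := pos_INR n).
    apply (is_series_eq _ _ _ _ (is_series_Rplus _ _ _ _ IH
      (is_series_Rplus _ _ _ _ (is_series_inv_telescope 2 (- 2 * (INR n + 1)) ltac:(lra))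
                               (is_series_inv_telescope 2 (2 * (INR n + 1)) ltac:(lra))))).
    + intros m. rewrite S_INR.
      replace (2 * INR m + -2 * (INR n + 1)) with (2 * INR m - 2 * (INR n + 1)) by ring.
      replace (2 * INR m + (2 + -2 * (INR n + 1))) with (2 * INR m - 2 * INR n) by ring.
      replace (2 * INR m + (2 + 2 * (INR n + 1))) with (2 * INR m + 2 * (INR n + 1 + 1)) by ring.
      ring.
    + field. lra.
Qed.

Lemma oddR_diff_neq (m n : nat) : m <> n -> oddR m - oddR n <> 0.
Proof.
  intros H E. apply H, INR_eq. unfold oddR in E. lra.
Qed.

(** The last term corrects the case m = n, where the left-hand side is / 0 = 0 but
    the second fraction on the right is not 0. *)
Lemma inv_diff_squares (m n : nat) :
  / (oddR m ^ 2 - oddR n ^ 2) =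
  / (2 * oddR n) * (/ (2 * INR m - 2 * INR n) - / (2 * INR m + 2 * (INR n + 1)))
  + (if Nat.eq_dec m n then / (4 * oddR n ^ 2) else 0).
Proof.
  assert (Hm := oddR_ge1 m). assert (Hn := oddR_ge1 n).
  destruct (Nat.eq_dec m n) as [->|H].
  - rewrite !Rminus_diag, Rinv_0.
    replace (2 * INR n + 2 * (INR n + 1)) with (2 * oddR n) by (unfold oddR; ring).
    field. lra.
  - assert (D := oddR_diff_neq m n H).
    replace (2 * INR m - 2 * INR n) with (oddR m - oddR n) by (unfold oddR; ring).
    replace (2 * INR m + 2 * (INR n + 1)) with (oddR m + oddR n) by (unfold oddR; ring).
    replace (oddR m ^ 2 - oddR n ^ 2) with ((oddR m - oddR n) * (oddR m + oddR n)) by ring.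
    field. repeat split; lra.
Qed.

(** The sum runs over all odd numbers different from 2n + 1, again by / 0 = 0. *)
Lemma sum_inv_diff_squares (n : nat) :
  is_series (fun m => / (oddR m ^ 2 - oddR n ^ 2)) (/ (4 * oddR n ^ 2)).
Proof.
  apply (is_series_eq _ _ _ _ (is_series_Rplus _ _ _ _
    (is_series_Rscal (/ (2 * oddR n)) _ _ (odd_differences_sum n))
    (is_series_single n (/ (4 * oddR n ^ 2))))).
  - intros m. now rewrite inv_diff_squares.
  - ring.
Qed.

(** The terms with m < 2n + 1 cancel in pairs around m = n; the proof is by induction
    on n, through [psi_step]. *)
Lemma alternating_differences_sum (n : nat) :
  is_series (fun m => (-1) ^ m * / (2 * INR m - 2 * INR n)) (- psi (2 * n + 1)).
Proof.
  assert (G : forall n, is_series (fun m => - ((-1) ^ m * / (2 * INR m + 2 * (INR n + 1)))) (- psi (2 * n + 1))).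
  { intros k. apply (is_series_eq _ _ _ _ (is_series_Rscal (-1) _ _ (psi_series (2 * k + 1)))); [|ring].
    intros m. rewrite <- oddR_INR. unfold oddR, Rdiv.
    replace (2 * INR k + 1 + 1 + 2 * INR m) with (2 * INR m + 2 * (INR k + 1)) by ring. ring. }
  induction n as [|n IH].
  - apply is_series_shift. apply (is_series_eq _ _ _ _ (G O)).
    + intros m. rewrite S_INR. simpl.
      replace (2 * (INR m + 1) - 2 * 0) with (2 * INR m + 2 * (0 + 1)) by ring. ring.
    + simpl. rewrite Rminus_diag, Rinv_0. ring.
  - apply is_series_shift.
    apply (is_series_eq _ _ _ _ (is_series_Rscal (-1) _ _ IH)).
    + intros m. rewrite !S_INR. simpl.
      replace (2 * (INR m + 1) - 2 * (INR n + 1)) with (2 * INR m - 2 * INR n) by ring. ring.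
    + assert (H := psi_step (2 * n + 1)). assert (Hn := pos_INR n).
      replace (2 * S n + 1)%nat with (2 * n + 1 + 2)%nat by lia.
      replace (psi (2 * n + 1 + 2)) with (/ (INR (2 * n + 1) + 1) - psi (2 * n + 1)) by lra.
      rewrite <- oddR_INR, S_INR. unfold oddR. simpl. field. lra.
Qed.

Lemma sum_alternating_inv_diff_squares (n : nat) :
  is_series (fun m => (-1) ^ m * / (oddR m ^ 2 - oddR n ^ 2))
    ((-1) ^ n / (4 * oddR n ^ 2) - psi (2 * n + 1) / oddR n).
Proof.
  assert (HX := oddR_ge1 n).
  assert (G : is_series (fun m => (-1) ^ m * / (2 * INR m + 2 * (INR n + 1))) (psi (2 * n + 1))).
  { apply (is_series_eq _ _ _ _ (psi_series (2 * n + 1))); trivial.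
    intros m. rewrite <- oddR_INR. unfold oddR, Rdiv. do 2 f_equal. ring. }
  apply (is_series_eq _ _ _ _ (is_series_Rplus _ _ _ _
    (is_series_Rscal (/ (2 * oddR n)) _ _
       (is_series_Rminus _ _ _ _ (alternating_differences_sum n) G))
    (is_series_single n ((-1) ^ n * / (4 * oddR n ^ 2))))).
  - intros m. rewrite inv_diff_squares.
    destruct (Nat.eq_dec m n) as [->|]; ring.
  - field. lra.
Qed.

(** The integers congruent to 2 modulo 4. *)
Definition evenR (j : nat) : R := 4 * INR j + 2.

Lemma evenR_ge2 (j : nat) : 2 <= evenR j.
Proof. unfold evenR. generalize (pos_INR j). lra. Qed.

Lemma evenR_oddR_gap (j n : nat) : 1 <= Rabs (evenR j - oddR n).
Proof.
  unfold evenR, oddR.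
  replace (4 * INR j + 2 - (2 * INR n + 1)) with (IZR (4 * Z.of_nat j + 1 - 2 * Z.of_nat n)).
  - rewrite <- abs_IZR. apply IZR_le. lia.
  - rewrite minus_IZR, plus_IZR, !mult_IZR, <- !INR_IZR_INZ. ring.
Qed.

(** The sum changes its sign when n increases by 1; since the series telescopes with
    step 4, the induction goes from n to n + 2. *)
Lemma even_odd_differences_sum (n : nat) :
  is_series (fun j => / (4 * INR j + (1 - 2 * INR n)) - / (4 * INR j + (3 + 2 * INR n)))
    (PI / 4 * (-1) ^ n).
Proof.
  assert (H0 : is_series (fun j => / (4 * INR j + 1) - / (4 * INR j + 3)) (PI / 4)).
  { rewrite <- psi_zero. exact psi_zero_series. }
  enough (H : forall n,
    is_series (fun j => / (4 * INR j + (1 - 2 * INR n)) - / (4 * INR j + (3 + 2 * INR n)))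
      (PI / 4 * (-1) ^ n) /\
    is_series (fun j => / (4 * INR j + (1 - 2 * INR (S n))) - / (4 * INR j + (3 + 2 * INR (S n))))
      (PI / 4 * (-1) ^ S n)) by apply H.
  clear n. intros n. induction n as [|n [IH0 IH1]]; split; trivial.
  - apply (is_series_eq _ _ _ _ H0); [|simpl; ring].
    intros j. simpl. f_equal; [|f_equal]; f_equal; ring.
  - apply (is_series_eq _ _ _ _ (is_series_Rplus _ _ _ _ (is_series_Rscal (-1) _ _ H0)
      (is_series_Rplus _ _ _ _ (is_series_inv_telescope 4 1 ltac:(lra))
                               (is_series_inv_telescope 4 (-1) ltac:(lra))))).
    + intros j. simpl.
      replace (4 * INR j + (4 + -1)) with (4 * INR j + 3) by ring.
      replace (4 * INR j + (1 - 2 * 1)) with (4 * INR j + -1) by ring.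
      replace (4 * INR j + (3 + 2 * 1)) with (4 * INR j + (4 + 1)) by ring. ring.
    + field.
  - assert (Hn := pos_INR n).
    apply (is_series_eq _ _ _ _ (is_series_Rplus _ _ _ _ IH0
      (is_series_Rplus _ _ _ _ (is_series_inv_telescope 4 (- (3 + 2 * INR n)) ltac:(lra))
                               (is_series_inv_telescope 4 (3 + 2 * INR n) ltac:(lra))))).
    + intros j. rewrite !S_INR.
      replace (4 * INR j + (4 + - (3 + 2 * INR n))) with (4 * INR j + (1 - 2 * INR n)) by ring.
      replace (4 * INR j + (1 - 2 * (INR n + 1 + 1))) with (4 * INR j + - (3 + 2 * INR n)) by ring.
      replace (4 * INR j + (3 + 2 * (INR n + 1 + 1))) with (4 * INR j + (4 + (3 + 2 * INR n))) by ring.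
      ring.
    + simpl pow. field. lra.
Qed.

Lemma sum_inv_even_odd_squares (n : nat) :
  is_series (fun j => / (evenR j ^ 2 - oddR n ^ 2)) (PI / 8 * (-1) ^ n / oddR n).
Proof.
  assert (HX := oddR_ge1 n).
  apply (is_series_eq _ _ _ _ (is_series_Rscal (/ (2 * oddR n)) _ _ (even_odd_differences_sum n))).
  - intros j. assert (HY := evenR_ge2 j). assert (HD := evenR_oddR_gap j n).
    assert (evenR j - oddR n <> 0).
    { intros E. rewrite E, Rabs_R0 in HD. lra. }
    replace (4 * INR j + (1 - 2 * INR n)) with (evenR j - oddR n) by (unfold evenR, oddR; ring).
    replace (4 * INR j + (3 + 2 * INR n)) with (evenR j + oddR n) by (unfold evenR, oddR; ring).
    replace (evenR j ^ 2 - oddR n ^ 2) with ((evenR j - oddR n) * (evenR j + oddR n)) by ring.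
    field. repeat split; lra.
  - field. lra.
Qed.

Lemma odd_even_differences_sum (M : nat) :
  is_series (fun n => / (2 * INR n + (1 + 2 * INR M)) - / (2 * INR n + (1 - 2 * INR M))) 0.
Proof.
  induction M as [|M IH].
  - apply (is_series_eq _ _ _ _ is_series_zero); trivial.
    intros n. simpl. rewrite Rmult_0_r, Rplus_0_r, Rminus_0_r. ring.
  - assert (HM := pos_INR M).
    apply (is_series_eq _ _ _ _ (is_series_Rplus _ _ _ _ IH
      (is_series_Rscal (-1) _ _
        (is_series_Rplus _ _ _ _ (is_series_inv_telescope 2 (1 + 2 * INR M) ltac:(lra))
                                 (is_series_inv_telescope 2 (- (1 + 2 * INR M)) ltac:(lra)))))).
    + intros n. rewrite S_INR.
      replace (2 * INR n + (2 + - (1 + 2 * INR M))) with (2 * INR n + (1 - 2 * INR M)) by ring.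
      replace (2 * INR n + (1 - 2 * (INR M + 1))) with (2 * INR n + - (1 + 2 * INR M)) by ring.
      replace (2 * INR n + (1 + 2 * (INR M + 1))) with (2 * INR n + (2 + (1 + 2 * INR M))) by ring.
      ring.
    + field. lra.
Qed.

Lemma sum_inv_odd_even_squares (j : nat) :
  is_series (fun n => / (oddR n ^ 2 - evenR j ^ 2)) 0.
Proof.
  assert (HY := evenR_ge2 j).
  apply (is_series_eq _ _ _ _ (is_series_Rscal (- / (2 * evenR j)) _ _ (odd_even_differences_sum (2 * j + 1)))); [|ring].
  intros n. assert (HX := oddR_ge1 n). assert (HD := evenR_oddR_gap j n).
  assert (evenR j - oddR n <> 0).
  { intros E. rewrite E, Rabs_R0 in HD. lra. }
  rewrite <- oddR_INR. unfold oddR at 1 2.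
  replace (2 * INR n + (1 + 2 * (2 * INR j + 1))) with (oddR n + evenR j) by (unfold evenR, oddR; ring).
  replace (2 * INR n + (1 - 2 * (2 * INR j + 1))) with (oddR n - evenR j) by (unfold evenR, oddR; ring).
  replace (oddR n ^ 2 - evenR j ^ 2) with ((oddR n - evenR j) * (oddR n + evenR j)) by ring.
  field. repeat split; lra.
Qed.

(** * Double sums of the kernel (x^-p - y^-p) / (y^2 - x^2) *)

(** The function t^(-3/2), which dominates the double sums in each variable. *)
Definition rho (t : R) : R := / (t * sqrt t).

Lemma rho_nonneg (t : R) : 0 < t -> 0 <= rho t.
Proof.
  intros H. apply Rlt_le, Rinv_0_lt_compat, Rmult_lt_0_compat; trivial.
  now apply sqrt_lt_R0.
Qed.

Lemma rho_decr (s t : R) : 0 < s -> s <= t -> rho t <= rho s.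
Proof.
  intros Hs H. unfold rho. assert (Ha := sqrt_lt_R0 s Hs).
  assert (Hb := sqrt_le_1_alt s t H).
  apply Rinv_le_contravar; [now apply Rmult_lt_0_compat|].
  apply Rmult_le_compat; lra.
Qed.

(** The sum of the n^(-3/2). *)
Definition rho_sum : R := Series (fun n => rho (INR n + 1)).

Lemma rho_is_series : is_series (fun n => rho (INR n + 1)) rho_sum.
Proof. apply Series_is, ex_series_three_halves. Qed.

Lemma rho_S_nonneg (n : nat) : 0 <= rho (INR n + 1).
Proof. apply rho_nonneg. generalize (pos_INR n); lra. Qed.

(** The distance between two natural numbers; one of the truncated differences is 0. *)
Definition dist (m n : nat) : nat := (m - n + (n - m))%nat.

Lemma dist_INR (m n : nat) : INR (dist m n) = Rabs (INR m - INR n).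
Proof.
  unfold dist. rewrite plus_INR. destruct (Nat.le_ge_cases m n) as [H|H].
  - replace (m - n)%nat with O by lia. rewrite minus_INR by trivial.
    apply le_INR in H. rewrite Rabs_left1 by lra. simpl. ring.
  - replace (n - m)%nat with O by lia. rewrite minus_INR by trivial.
    apply le_INR in H. rewrite Rabs_pos_eq by lra. simpl. ring.
Qed.

Lemma rho_dist_sum (n : nat) : exists l, l <= 2 * rho_sum /\
  is_series (fun m => rho (INR (dist m n) + 1)) l.
Proof.
  set (f := fun d => rho (INR d + 1)).
  assert (H : is_series (fun m => f (dist m n)) (rho_sum + sum_n f n - f O)).
  { induction n as [|n IH].
    - apply (is_series_eq _ _ _ _ rho_is_series).
      + intros m. unfold dist, f. do 3 f_equal. lia.
      + rewrite sum_O. ring.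
    - apply is_series_shift.
      apply (is_series_eq _ _ _ _ IH); trivial.
      rewrite sum_n_S. change (dist 0 (S n)) with (S n). ring. }
  exists (rho_sum + sum_n f n - f O). split; trivial.
  assert (A := sum_n_le_limit f rho_sum n rho_S_nonneg rho_is_series).
  assert (B := rho_S_nonneg O). fold (f O) in B. lra.
Qed.

Lemma dominated_double_series (a b : nat -> nat -> R) :
  (forall n, exists l, l <= 2 * rho_sum /\ is_series (b n) l) ->
  (forall n m, Rabs (a n m) <= b n m * (2 * rho (INR n + 1))) ->
  (forall n, ex_series (fun m => Rabs (a n m))) /\
  ex_series (fun n => Series (fun m => Rabs (a n m))).
Proof.
  intros Hb Ha.
  assert (H : forall n, ex_series (fun m => b n m * (2 * rho (INR n + 1))) /\
    Series (fun m => b n m * (2 * rho (INR n + 1))) <= 4 * rho_sum * rho (INR n + 1)).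
  { intros n. destruct (Hb n) as (l & Hl & H).
    assert (H' : is_series (fun m => b n m * (2 * rho (INR n + 1))) (2 * rho (INR n + 1) * l)).
    { apply (is_series_eq _ _ _ _ (is_series_Rscal (2 * rho (INR n + 1)) _ _ H)); trivial.
      intros m. ring. }
    split; [eexists; exact H'|]. rewrite (is_series_unique _ _ H').
    assert (K := rho_S_nonneg n). nra. }
  assert (E : forall n, ex_series (fun m => Rabs (a n m))).
  { intros n. apply (ex_series_le_R _ (fun m => b n m * (2 * rho (INR n + 1)))); [|apply H].
    intros m. rewrite Rabs_Rabsolu. apply Ha. }
  split; trivial.
  apply (ex_series_le_R _ (fun n => 4 * rho_sum * rho (INR n + 1))).
  - intros n. rewrite Rabs_pos_eq.
    + apply Rle_trans with (2 := proj2 (H n)). apply Series_le; [|apply H].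
      intros m. split; [apply Rabs_pos|apply Ha].
    + apply Series_nonneg; trivial. intros; apply Rabs_pos.
  - eexists. apply is_series_Rscal, rho_is_series.
Qed.

(** From |y - x| >= (d + 1) / 2 and from the bound of y + x below by the geometric
    mean of d + 1 and x. The case y = x is covered by / 0 = 0. *)
Lemma kernel_bound (d x y t c : R) (p : nat) :
  0 <= d -> 0 < t -> t <= x -> 1 <= x -> 1 <= y -> Rabs c <= 1 -> 
  (y = x \/ (d + 1) / 2 <= Rabs (y - x)) -> d + 1 <= y + x ->
  Rabs (c / x ^ S p * / (y ^ 2 - x ^ 2)) <= rho (d + 1) * (2 * rho t).
Proof.
  intros Hd Ht Htx Hx Hy Hc Hg Hs.
  assert (P1 : 0 <= rho (d + 1)) by (apply rho_nonneg; lra).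
  assert (P2 : 0 <= rho t) by (apply rho_nonneg; lra).
  destruct Hg as [->|Hg].
  { rewrite Rminus_diag, Rinv_0, Rmult_0_r, Rabs_R0. nra. }
  apply Rle_trans with (rho (d + 1) * (2 * rho x)).
  2: { assert (rho x <= rho t) by now apply rho_decr. nra. }
  replace (y ^ 2 - x ^ 2) with ((y - x) * (y + x)) by ring.
  unfold Rdiv. rewrite Rinv_mult, !Rabs_mult.
  assert (Hp : 1 <= x ^ p) by now apply pow_R1_Rle.
  assert (Hxp : 0 < / x ^ S p <= / x).
  { split; [apply Rinv_0_lt_compat, pow_lt; lra|].
    apply Rinv_le_contravar; [lra|]. simpl. nra. }
  rewrite (Rabs_pos_eq (/ x ^ S p)), (Rabs_pos_eq (/ (y + x))), Rabs_inv
    by (first [lra | apply Rlt_le, Rinv_0_lt_compat; lra]).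
  assert (Hd1 : / Rabs (y - x) <= 2 * / (d + 1)).
  { replace (2 * / (d + 1)) with (/ ((d + 1) / 2)) by (field; lra).
    apply Rinv_le_contravar; lra. }
  assert (Hsd := sqrt_lt_R0 (d + 1) ltac:(lra)). assert (Esd := sqrt_sqrt (d + 1) ltac:(lra)).
  assert (Hsx := sqrt_lt_R0 x ltac:(lra)). assert (Esx := sqrt_sqrt x ltac:(lra)).
  assert (Hsum : / (y + x) <= / (sqrt (d + 1) * sqrt x)).
  { apply Rinv_le_contravar; [now apply Rmult_lt_0_compat|].
    destruct (Rle_lt_dec (sqrt (d + 1)) (sqrt x)).
    - apply Rle_trans with (sqrt x * sqrt x); [apply Rmult_le_compat_r|]; lra.
    - apply Rle_trans with (sqrt (d + 1) * sqrt (d + 1)); [apply Rmult_le_compat_l|]; lra. }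
  assert (0 < / Rabs (y - x)) by (apply Rinv_0_lt_compat; lra).
  assert (0 < / (y + x)) by (apply Rinv_0_lt_compat; lra).
  apply Rle_trans with (1 * / x * (2 * / (d + 1) * / (sqrt (d + 1) * sqrt x))).
  - apply Rmult_le_compat.
    + apply Rmult_le_pos; [apply Rabs_pos|lra].
    + apply Rmult_le_pos; lra.
    + apply Rmult_le_compat; try lra. apply Rabs_pos.
    + apply Rmult_le_compat; lra.
  - apply Req_le. unfold rho. field. repeat split; lra.
Qed.

Lemma odd_dominated (c : nat -> R) (p n m : nat) : (forall m, Rabs (c m) <= 1) ->
  forall i, Rabs (c i / oddR n ^ S p * / (oddR m ^ 2 - oddR n ^ 2))
  <= rho (INR (dist m n) + 1) * (2 * rho (INR n + 1)).
Proof.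
  intros Hc i. assert (Hn := pos_INR n). assert (Hm := pos_INR m).
  apply kernel_bound; try apply oddR_ge1; trivial.
  - apply pos_INR.
  - lra.
  - unfold oddR; lra.
  - destruct (Nat.eq_dec m n) as [->|H]; [now left|right].
    assert (1 <= INR (dist m n)).
    { apply (le_INR 1). unfold dist. lia. }
    rewrite dist_INR in *. unfold oddR.
    replace (2 * INR m + 1 - (2 * INR n + 1)) with (2 * (INR m - INR n)) by ring.
    rewrite Rabs_mult, (Rabs_pos_eq 2); lra.
  - rewrite dist_INR. unfold oddR.
    assert (Rabs (INR m - INR n) <= INR m + INR n) by (apply Rabs_le; lra). lra.
Qed.

Lemma even_dist_gap (j n : nat) :
  (INR (dist (2 * j) n) + 1) / 2 <= Rabs (evenR j - oddR n).
Proof.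
  assert (H := evenR_oddR_gap j n). rewrite dist_INR, mult_INR. simpl (INR 2).
  unfold evenR, oddR in *.
  replace (4 * INR j + 2 - (2 * INR n + 1)) with (2 * (2 * INR j - INR n) + 1) in * by ring.
  replace ((1 + 1) * INR j - INR n) with (2 * INR j - INR n) by ring.
  set (v := 2 * INR j - INR n) in *.
  unfold Rabs in *. destruct (Rcase_abs v), (Rcase_abs (2 * v + 1)); lra.
Qed.

Lemma dist_even_le (j n : nat) : INR (dist (2 * j) n) + 1 <= evenR j + oddR n.
Proof.
  assert (Hn := pos_INR n). assert (Hj := pos_INR j).
  rewrite dist_INR, mult_INR. simpl (INR 2). unfold evenR, oddR.
  assert (Rabs ((1 + 1) * INR j - INR n) <= 2 * INR j + INR n) by (apply Rabs_le; lra).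
  lra.
Qed.

Lemma even_dominated (p n j : nat) :
  Rabs (1 / evenR j ^ S p * / (oddR n ^ 2 - evenR j ^ 2))
  <= rho (INR (dist n (2 * j)) + 1) * (2 * rho (INR j + 1)).
Proof.
  assert (Hn := pos_INR n). assert (Hj := evenR_ge2 j). assert (Hj' := pos_INR j).
  replace (dist n (2 * j)) with (dist (2 * j) n) by (unfold dist; lia).
  apply kernel_bound; try apply oddR_ge1.
  - apply pos_INR.
  - lra.
  - unfold evenR; lra.
  - lra.
  - rewrite Rabs_R1; lra.
  - right. rewrite Rabs_minus_sym. apply even_dist_gap.
  - rewrite (Rplus_comm (oddR n)). apply dist_even_le.
Qed.

(** The kernel (x^-p - y^-p) / (y^2 - x^2), extended by continuity to x = y. *)
Definition kernel (p : nat) (x y : R) : R :=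
  if Req_EM_T x y then INR p / 2 / x ^ (p + 2)
  else (/ x ^ p - / y ^ p) / (y ^ 2 - x ^ 2).

Lemma oddR_inj (m n : nat) : oddR m = oddR n -> m = n.
Proof. unfold oddR. intros H. apply INR_eq. lra. Qed.

Lemma kernel_odd_split (p n m : nat) :
  kernel p (oddR n) (oddR m) =
  1 / oddR n ^ p * / (oddR m ^ 2 - oddR n ^ 2)
  + 1 / oddR m ^ p * / (oddR n ^ 2 - oddR m ^ 2)
  + (if Nat.eq_dec m n then INR p / 2 / oddR n ^ (p + 2) else 0).
Proof.
  unfold kernel. destruct (Nat.eq_dec m n) as [->|H], (Req_EM_T _ _) as [E|E]; try easy.
  - rewrite Rminus_diag, Rinv_0. ring.
  - exfalso. now apply H, eq_sym, oddR_inj.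
  - replace (oddR n ^ 2 - oddR m ^ 2) with (- (oddR m ^ 2 - oddR n ^ 2)) by ring.
    rewrite Rinv_opp. unfold Rdiv. ring.
Qed.

(** The double sum of the kernel over odd numbers, with weights c on the second
    variable and row sums v. For the exponent q = p + 1, the diagonal contributes
    q / 2, and the part in y^-q, summed first over the other variable, contributes 1 / 4, to the
    coefficient of the last series. *)
Lemma kernel_odd_sum (p : nat) (c v : nat -> R) :
  (forall m, Rabs (c m) <= 1) ->
  (forall n, is_series (fun m => c m * / (oddR m ^ 2 - oddR n ^ 2)) (v n)) ->
  (forall n, ex_series (fun m => c m * kernel (S p) (oddR n) (oddR m))) /\
  ex_series (fun n => v n / oddR n ^ S p) /\
  is_series (fun n => Series (fun m => c m * kernel (S p) (oddR n) (oddR m)))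
    (Series (fun n => v n / oddR n ^ S p)
     + (2 * INR (S p) + 1) / 4 * Series (fun n => c n / oddR n ^ (S p + 2))).
Proof.
  intros Hc Hv.
  set (a := fun n m => c m / oddR n ^ S p * / (oddR m ^ 2 - oddR n ^ 2)).
  set (b := fun m n => c m / oddR m ^ S p * / (oddR n ^ 2 - oddR m ^ 2)).
  destruct (dominated_double_series a (fun n m => rho (INR (dist m n) + 1)) rho_dist_sum
    (fun n m => odd_dominated c p n m Hc m)) as [A1 A2].
  destruct (dominated_double_series b (fun n m => rho (INR (dist m n) + 1)) rho_dist_sum
    (fun n m => odd_dominated c p n m Hc n)) as [B1 B2].
  destruct (Fubini_series a A1 A2) as (FA & _).
  destruct (Fubini_series b B1 B2) as (FB & CB & SB).
  assert (HX : forall n, oddR n <> 0) by (intros n; generalize (oddR_ge1 n); lra).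
  assert (HXp : forall n q, oddR n ^ q <> 0) by (intros; now apply pow_nonzero).
  assert (Ra : forall n, is_series (a n) (v n / oddR n ^ S p)).
  { intros n. apply (is_series_eq _ _ _ _ (is_series_Rscal (/ oddR n ^ S p) _ _ (Hv n))).
    - intros m. unfold a, Rdiv. ring.
    - unfold Rdiv. ring. }
  assert (Rb : forall m, is_series (b m) (/ 4 * (c m / oddR m ^ (S p + 2)))).
  { intros m. apply (is_series_eq _ _ _ _ (is_series_Rscal (c m / oddR m ^ S p) _ _ (sum_inv_diff_squares m))); trivial.
    rewrite pow_add. field. auto. }
  assert (EB : ex_series (fun n => c n / oddR n ^ (S p + 2))).
  { destruct FB as [l Hl]. exists (4 * l).
    apply (is_series_eq _ _ _ _ (is_series_Rscal 4 _ _ Hl)); trivial.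
    intros n. rewrite (is_series_unique _ _ (Rb n)). field. auto. }
  assert (EA : ex_series (fun n => v n / oddR n ^ S p)).
  { apply (ex_series_ext (fun n => Series (a n))); trivial.
    intros n. exact (is_series_unique _ _ (Ra n)). }
  assert (Row : forall n, is_series (fun m => c m * kernel (S p) (oddR n) (oddR m))
     (v n / oddR n ^ S p + Series (fun m => b m n) + INR (S p) / 2 * (c n / oddR n ^ (S p + 2)))).
  { intros n. apply (is_series_eq _ _ _ _ (is_series_Rplus _ _ _ _
      (is_series_Rplus _ _ _ _ (Ra n) (Series_is _ (CB n)))
      (is_series_single n (INR (S p) / 2 * (c n / oddR n ^ (S p + 2)))))); trivial.
    intros m. rewrite kernel_odd_split. unfold a, b.
    destruct (Nat.eq_dec m n) as [->|]; unfold Rdiv; ring. }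
  split; [intros n; eexists; apply Row|]. split; trivial.
  apply (is_series_eq _ _ _ _ (is_series_Rplus _ _ _ _
    (is_series_Rplus _ _ _ _ (Series_is _ EA) SB)
    (is_series_Rscal (INR (S p) / 2) _ _ (Series_is _ EB)))).
  - intros n. symmetry. apply is_series_unique, Row.
  - rewrite (Series_ext _ _ (fun m => is_series_unique _ _ (Rb m))), Series_scal_l. field.
Qed.

(** The sum of the N^-s over the odd numbers N. *)
Definition lam (s : nat) : R := Series (fun n => / oddR n ^ s).

Lemma beta_oddR (s : nat) : beta s = Series (fun n => (-1) ^ n / oddR n ^ s).
Proof. apply Series_ext. intros n. now rewrite oddR_INR. Qed.

Lemma ex_series_odd_pow (c : nat -> R) (p : nat) : (forall m, Rabs (c m) <= 1) ->
  ex_series (fun n => c n / oddR n ^ (p + 2)).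
Proof.
  intros Hc. apply (ex_series_le_R _ (fun n => rho (INR n + 1))).
  - intros n. assert (Hn := pos_INR n). assert (HX := oddR_ge1 n).
    unfold Rdiv. rewrite Rabs_mult, (Rabs_pos_eq (/ _))
      by (apply Rlt_le, Rinv_0_lt_compat, pow_lt; lra).
    assert (Hs := sqrt_lt_R0 (INR n + 1) ltac:(lra)).
    assert (Es := sqrt_sqrt (INR n + 1) ltac:(lra)).
    assert (/ oddR n ^ (p + 2) <= rho (INR n + 1)).
    { unfold rho. apply Rinv_le_contravar; [apply Rmult_lt_0_compat; lra|].
      rewrite pow_add. assert (1 <= oddR n ^ p) by now apply pow_R1_Rle.
      assert (INR n + 1 <= oddR n) by (unfold oddR; lra).
      assert (sqrt (INR n + 1) <= INR n + 1) by nra.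
      assert ((INR n + 1) * sqrt (INR n + 1) <= oddR n ^ 2) by nra.
      assert (0 <= oddR n ^ 2) by apply pow2_ge_0. nra. }
    assert (P := rho_S_nonneg n). assert (P' := Rabs_pos (c n)). specialize (Hc n).
    assert (0 < / oddR n ^ (p + 2)) by (apply Rinv_0_lt_compat, pow_lt; lra). nra.
  - exists rho_sum. apply rho_is_series.
Qed.

Lemma lam_is_series (p : nat) : is_series (fun n => / oddR n ^ (p + 2)) (lam (p + 2)).
Proof.
  apply Series_is. apply (ex_series_ext (fun n => 1 / oddR n ^ (p + 2))).
  - intros n. unfold Rdiv. apply Rmult_1_l.
  - apply (ex_series_odd_pow (fun _ => 1)). intros _. rewrite Rabs_R1. lra.
Qed.

Lemma Rabs_sign (m : nat) : Rabs ((-1) ^ m) <= 1.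
Proof. rewrite pow_1_abs. lra. Qed.

Lemma beta_is_series (p : nat) :
  is_series (fun n => (-1) ^ n / oddR n ^ (p + 2)) (beta (p + 2)).
Proof.
  rewrite beta_oddR. apply Series_is, ex_series_odd_pow, Rabs_sign.
Qed.

Lemma kernel_sum_plain (p : nat) :
  (forall n, ex_series (fun m => kernel (S p) (oddR n) (oddR m))) /\
  is_series (fun n => Series (fun m => kernel (S p) (oddR n) (oddR m)))
    ((INR (S p) + 1) / 2 * lam (S p + 2)).
Proof.
  destruct (kernel_odd_sum p (fun _ => 1) (fun n => / (4 * oddR n ^ 2))) as (E & _ & HS).
  - intros _. rewrite Rabs_R1. lra.
  - intros n. apply (is_series_eq _ _ _ _ (sum_inv_diff_squares n)); trivial. intros m. ring.
  - split.
    + intros n. apply (ex_series_ext _ _ (fun m => Rmult_1_l _) (E n)).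
    + apply (is_series_eq _ _ _ _ HS).
      * intros n. apply Series_ext. intros m. ring.
      * rewrite (Series_ext (fun n => 1 / oddR n ^ (S p + 2)) (fun n => / oddR n ^ (S p + 2)))
          by (intros n; unfold Rdiv; ring).
        rewrite (Series_ext _ (fun n => / 4 * / oddR n ^ (S p + 2))).
        -- rewrite Series_scal_l. fold (lam (S p + 2)). field.
        -- intros n. assert (HX := oddR_ge1 n). rewrite pow_add. field.
           split; [|apply pow_nonzero]; lra.
Qed.

Lemma kernel_sum_alternating (p : nat) :
  is_series (fun n => Series (fun m => (-1) ^ m * kernel (S p) (oddR n) (oddR m)))
    ((INR (S p) + 1) / 2 * beta (S p + 2)
     - Series (fun n => psi (2 * n + 1) / oddR n ^ (S p + 1))).
Proof.
  destruct (kernel_odd_sum p (fun m => (-1) ^ m) _ Rabs_sign sum_alternating_inv_diff_squares)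
    as (_ & V & HS).
  assert (T : forall n, ((-1) ^ n / (4 * oddR n ^ 2) - psi (2 * n + 1) / oddR n) / oddR n ^ S p
     = / 4 * ((-1) ^ n / oddR n ^ (S p + 2)) - psi (2 * n + 1) / oddR n ^ (S p + 1)).
  { intros n. assert (HX := oddR_ge1 n). rewrite !pow_add. field.
    repeat split; repeat apply pow_nonzero; lra. }
  assert (Eg : is_series (fun n => psi (2 * n + 1) / oddR n ^ (S p + 1))
    (/ 4 * beta (S p + 2) -
     Series (fun n => ((-1) ^ n / (4 * oddR n ^ 2) - psi (2 * n + 1) / oddR n) / oddR n ^ S p))).
  { apply (is_series_eq _ _ _ _ (is_series_Rminus _ _ _ _
      (is_series_Rscal (/ 4) _ _ (beta_is_series (S p))) (Series_is _ V))); trivial.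
    intros n. rewrite T. ring. }
  apply (is_series_eq _ _ _ _ HS); trivial.
  rewrite (is_series_unique _ _ Eg), <- (beta_oddR (S p + 2)). field.
Qed.

Lemma kernel_even_split (p n j : nat) :
  kernel p (oddR n) (evenR j) =
  1 / oddR n ^ p * / (evenR j ^ 2 - oddR n ^ 2)
  + 1 / evenR j ^ p * / (oddR n ^ 2 - evenR j ^ 2).
Proof.
  unfold kernel. destruct (Req_EM_T _ _) as [E|_].
  - exfalso. assert (H := evenR_oddR_gap j n). rewrite E, Rminus_diag, Rabs_R0 in H. lra.
  - replace (oddR n ^ 2 - evenR j ^ 2) with (- (evenR j ^ 2 - oddR n ^ 2)) by ring.
    rewrite Rinv_opp. unfold Rdiv. ring.
Qed.

(** The part in y^-p disappears, by [sum_inv_odd_even_squares]. *)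
Lemma kernel_sum_even (p : nat) :
  (forall n, ex_series (fun j => kernel (S p) (oddR n) (evenR j))) /\
  is_series (fun n => Series (fun j => kernel (S p) (oddR n) (evenR j)))
    (PI / 8 * beta (p + 2)).
Proof.
  set (a := fun n j => 1 / oddR n ^ S p * / (evenR j ^ 2 - oddR n ^ 2)).
  set (b := fun j n => 1 / evenR j ^ S p * / (oddR n ^ 2 - evenR j ^ 2)).
  destruct (dominated_double_series b (fun j n => rho (INR (dist n (2 * j)) + 1))
     (fun j => rho_dist_sum (2 * j)) (fun j n => even_dominated p n j)) as [B1 B2].
  destruct (Fubini_series b B1 B2) as (FB & CB & SB).
  assert (Rb : forall j, is_series (b j) 0).
  { intros j. apply (is_series_eq _ _ _ _ (is_series_Rscal (1 / evenR j ^ S p) _ _ (sum_inv_odd_even_squares j))); trivial. ring. }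
  assert (Ra : forall n, is_series (a n) (PI / 8 * ((-1) ^ n / oddR n ^ (p + 2)))).
  { intros n. assert (HX := oddR_ge1 n).
    apply (is_series_eq _ _ _ _ (is_series_Rscal (1 / oddR n ^ S p) _ _ (sum_inv_even_odd_squares n))); trivial.
    replace (p + 2)%nat with (S (S p)) by lia. simpl pow. field. repeat split; repeat apply pow_nonzero; lra. }
  assert (Row : forall n, is_series (fun j => kernel (S p) (oddR n) (evenR j))
     (PI / 8 * ((-1) ^ n / oddR n ^ (p + 2)) + Series (fun j => b j n))).
  { intros n. apply (is_series_eq _ _ _ _ (is_series_Rplus _ _ _ _ (Ra n) (Series_is _ (CB n)))); trivial.
    intros j. now rewrite kernel_even_split. }
  split; [intros n; eexists; apply Row|].
  apply (is_series_eq _ _ _ _ (is_series_Rplus _ _ _ _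
    (is_series_Rscal (PI / 8) _ _ (beta_is_series p)) SB)).
  - intros n. symmetry. apply is_series_unique, Row.
  - rewrite (Series_ext _ _ (fun j => is_series_unique _ _ (Rb j))).
    rewrite (is_series_unique _ _ is_series_zero). ring.
Qed.

Lemma sum_geometric_step (a b : R) (k : nat) :
  sum_n (fun i => a ^ i * b ^ (S k - i)) (S k) =
  b * sum_n (fun i => a ^ i * b ^ (k - i)) k + a ^ S k :> R.
Proof.
  rewrite sum_n_S, Nat.sub_diag, <- sum_n_Rscal. simpl (b ^ 0). rewrite Rmult_1_r.
  f_equal. apply sum_n_eq_loc. intros i Hi. rewrite Nat.sub_succ_l by trivial.
  simpl pow. ring.
Qed.

Lemma sum_geometric_diff (a b : R) (k : nat) :
  (a - b) * sum_n (fun i => a ^ i * b ^ (k - i)) k = a ^ S k - b ^ S k.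
Proof.
  induction k as [|k IH].
  - rewrite sum_O. simpl. ring.
  - rewrite sum_geometric_step, Rmult_plus_distr_l.
    replace ((a - b) * (b * sum_n (fun i => a ^ i * b ^ (k - i)) k))
      with (b * ((a - b) * sum_n (fun i => a ^ i * b ^ (k - i)) k)) by ring.
    rewrite IH. simpl. ring.
Qed.

Lemma sum_geometric_same (a : R) (k : nat) :
  sum_n (fun i => a ^ i * a ^ (k - i)) k = INR (S k) * a ^ k :> R.
Proof.
  induction k as [|k IH].
  - rewrite sum_O. simpl. ring.
  - rewrite sum_geometric_step, IH, (S_INR (S k)). simpl pow. ring.
Qed.

Lemma inv_pow_even (x : R) (i : nat) : 0 < x -> / x ^ (2 * i) = (/ x ^ 2) ^ i.
Proof. intros H. now rewrite pow_mult, pow_inv. Qed.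

(** The coefficients of z^(2k + 4) in z^4 / ((x^2 - z^2) (y^2 - z^2)). *)
Lemma kernel_even_expansion (k : nat) (x y : R) : 0 < x -> 0 < y ->
  sum_n (fun i => / x ^ (2 * (i + 1)) * / y ^ (2 * (k - i + 1))) k
  = kernel (2 * k + 2) x y :> R.
Proof.
  intros Hx Hy.
  rewrite (sum_n_eq _ (fun i => (/ x ^ 2 * / y ^ 2) * ((/ x ^ 2) ^ i * (/ y ^ 2) ^ (k - i)))).
  2: { intros i. rewrite !inv_pow_even, !pow_add, !pow_1 by trivial. ring. }
  rewrite sum_n_Rscal. unfold kernel.
  destruct (Req_EM_T x y) as [<-|E].
  - rewrite sum_geometric_same. replace (2 * k + 2 + 2)%nat with (2 * k + 4)%nat by lia.
    rewrite pow_add, pow_mult, plus_INR, mult_INR, S_INR. simpl (INR 2).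
    rewrite pow_inv. field. repeat split; repeat apply pow_nonzero; lra.
  - assert (G := sum_geometric_diff (/ x ^ 2) (/ y ^ 2) k).
    set (T := sum_n _ k) in *.
    assert (D : y ^ 2 - x ^ 2 <> 0).
    { replace (y ^ 2 - x ^ 2) with ((y - x) * (y + x)) by ring.
      apply Rmult_integral_contrapositive. split; lra. }
    replace (2 * k + 2)%nat with (2 * S k)%nat by lia.
    rewrite !inv_pow_even, <- G by trivial. field. repeat split; lra.
Qed.

(** The analogue for odd p; the subtracted fraction is the one that leads to phi when it
    is summed over y. *)
Lemma kernel_odd_expansion (k : nat) (x y : R) : 0 < x -> 0 < y ->
  sum_n (fun i => / y ^ (2 * i + 1) * / x ^ (2 * (k - i + 1))) k
    - / x ^ (2 * (k + 1)) * / (x + y)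
  = kernel (2 * k + 1) x y.
Proof.
  intros Hx Hy.
  rewrite (sum_n_eq _ (fun i => (/ x ^ 2 * / y) * ((/ y ^ 2) ^ i * (/ x ^ 2) ^ (k - i)))).
  2: { intros i. rewrite (pow_add y), Rinv_mult, !inv_pow_even, !pow_add, !pow_1 by trivial. ring. }
  rewrite sum_n_Rscal. unfold kernel.
  destruct (Req_EM_T x y) as [<-|E].
  - rewrite sum_geometric_same. replace (2 * k + 1 + 2)%nat with (2 * k + 3)%nat by lia.
    replace (2 * (k + 1))%nat with (2 * k + 2)%nat by lia.
    rewrite !pow_add, pow_mult, plus_INR, mult_INR, S_INR. simpl (INR 2). simpl (INR 1).
    rewrite pow_inv. field. repeat split; repeat apply pow_nonzero; lra.
  - assert (G := sum_geometric_diff (/ y ^ 2) (/ x ^ 2) k).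
    set (T := sum_n _ k) in *.
    assert (D : y ^ 2 - x ^ 2 <> 0).
    { replace (y ^ 2 - x ^ 2) with ((y - x) * (y + x)) by ring.
      apply Rmult_integral_contrapositive. split; lra. }
    replace (/ x ^ (2 * k + 1)) with (x * (/ x ^ 2) ^ S k).
    2: { rewrite <- inv_pow_even by trivial. replace (2 * S k)%nat with (S (2 * k + 1)) by lia.
         rewrite <- tech_pow_Rmult. field. repeat split; repeat apply pow_nonzero; lra. }
    replace (/ y ^ (2 * k + 1)) with (y * (/ y ^ 2) ^ S k).
    2: { rewrite <- inv_pow_even by trivial. replace (2 * S k)%nat with (S (2 * k + 1)) by lia.
         rewrite <- tech_pow_Rmult. field. repeat split; repeat apply pow_nonzero; lra. }
    replace (2 * (k + 1))%nat with (2 * S k)%nat by lia.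
    rewrite inv_pow_even by trivial.
    replace ((/ y ^ 2) ^ S k) with ((/ x ^ 2) ^ S k + (/ y ^ 2 - / x ^ 2) * T) by lra.
    field. repeat split; lra.
Qed.

(** * Convolutions of lambda and beta values *)

Lemma even_pow_index (i : nat) : (2 * (i + 1) = 2 * i + 2)%nat.
Proof. lia. Qed.

(** This is equivalent to Euler's recurrence for the values of zeta at the even
    integers. *)
Lemma lam_convolution (k : nat) :
  sum_n (fun i => lam (2 * (i + 1)) * lam (2 * (k - i + 1))) k
  = (2 * INR k + 3) / 2 * lam (2 * k + 4) :> R.
Proof.
  replace (2 * k + 4)%nat with (S (2 * k + 1) + 2)%nat by lia.
  destruct (kernel_sum_plain (2 * k + 1)) as [_ H].
  replace ((2 * INR k + 3) / 2) with ((INR (S (2 * k + 1)) + 1) / 2)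
    by (rewrite S_INR, <- oddR_INR; unfold oddR; field).
  refine (is_series_limit_unique _ _ _ _ H).
  assert (Row : forall n, Series (fun m => kernel (S (2 * k + 1)) (oddR n) (oddR m)) =
     sum_n (fun i => / oddR n ^ (2 * (i + 1)) * lam (2 * (k - i + 1))) k :> R).
  { intros n. apply is_series_unique.
    apply (is_series_eq (fun m => sum_n (fun i => / oddR n ^ (2 * (i + 1)) * / oddR m ^ (2 * (k - i + 1))) k)
             _ (sum_n (fun i => / oddR n ^ (2 * (i + 1)) * lam (2 * (k - i + 1))) k)); trivial.
    - apply (is_series_sum_n (fun m i => / oddR n ^ (2 * (i + 1)) * / oddR m ^ (2 * (k - i + 1)))).
      intros i. apply is_series_Rscal. rewrite even_pow_index. apply lam_is_series.
    - intros m. rewrite kernel_even_expansion.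
      + f_equal. lia.
      + generalize (oddR_ge1 n); lra.
      + generalize (oddR_ge1 m); lra. }
  apply (is_series_eq (fun n => sum_n (fun i => / oddR n ^ (2 * (i + 1)) * lam (2 * (k - i + 1))) k)
           _ (sum_n (fun i => lam (2 * (i + 1)) * lam (2 * (k - i + 1))) k)); trivial.
  - apply (is_series_sum_n (fun n i => / oddR n ^ (2 * (i + 1)) * lam (2 * (k - i + 1)))
             (fun i => lam (2 * (i + 1)) * lam (2 * (k - i + 1)))).
    intros i. rewrite Rmult_comm.
    apply (is_series_eq (fun n => lam (2 * (k - i + 1)) * / oddR n ^ (2 * (i + 1))) _
             (lam (2 * (k - i + 1)) * lam (2 * (i + 1)))); trivial.
    + apply is_series_Rscal. rewrite (even_pow_index i). apply lam_is_series.
    + intros n. apply Rmult_comm.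
  - intros n. now rewrite Row.
Qed.

Lemma lam_beta_convolution (k : nat) :
  sum_n (fun i => lam (2 * (i + 1)) * beta (2 * (k - i + 1))) k
  = (2 * INR k + 3) / 2 * beta (2 * k + 4)
    - Series (fun n => psi (2 * n + 1) / oddR n ^ (2 * k + 3)) :> R.
Proof.
  replace (2 * k + 4)%nat with (S (2 * k + 1) + 2)%nat by lia.
  replace (2 * k + 3)%nat with (S (2 * k + 1) + 1)%nat by lia.
  assert (H := kernel_sum_alternating (2 * k + 1)).
  replace ((2 * INR k + 3) / 2) with ((INR (S (2 * k + 1)) + 1) / 2)
    by (rewrite S_INR, <- oddR_INR; unfold oddR; field).
  refine (is_series_limit_unique _ _ _ _ H).
  assert (Row : forall n, Series (fun m => (-1) ^ m * kernel (S (2 * k + 1)) (oddR n) (oddR m)) =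
     sum_n (fun i => / oddR n ^ (2 * (i + 1)) * beta (2 * (k - i + 1))) k :> R).
  { intros n. apply is_series_unique.
    apply (is_series_eq (fun m => sum_n (fun i => / oddR n ^ (2 * (i + 1)) * ((-1) ^ m / oddR m ^ (2 * (k - i + 1)))) k)
             _ (sum_n (fun i => / oddR n ^ (2 * (i + 1)) * beta (2 * (k - i + 1))) k)); trivial.
    - apply (is_series_sum_n (fun m i => / oddR n ^ (2 * (i + 1)) * ((-1) ^ m / oddR m ^ (2 * (k - i + 1))))).
      intros i. apply is_series_Rscal. rewrite even_pow_index. apply beta_is_series.
    - intros m. replace (S (2 * k + 1)) with (2 * k + 2)%nat by lia.
      rewrite <- kernel_even_expansion, <- sum_n_Rscal.
      + apply sum_n_eq. intros i. unfold Rdiv. ring.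
      + generalize (oddR_ge1 n); lra.
      + generalize (oddR_ge1 m); lra. }
  apply (is_series_eq (fun n => sum_n (fun i => / oddR n ^ (2 * (i + 1)) * beta (2 * (k - i + 1))) k)
           _ (sum_n (fun i => lam (2 * (i + 1)) * beta (2 * (k - i + 1))) k)); trivial.
  - apply (is_series_sum_n (fun n i => / oddR n ^ (2 * (i + 1)) * beta (2 * (k - i + 1)))
             (fun i => lam (2 * (i + 1)) * beta (2 * (k - i + 1)))).
    intros i. rewrite Rmult_comm.
    apply (is_series_eq (fun n => beta (2 * (k - i + 1)) * / oddR n ^ (2 * (i + 1))) _
             (beta (2 * (k - i + 1)) * lam (2 * (i + 1)))); trivial.
    + apply is_series_Rscal. rewrite (even_pow_index i). apply lam_is_series.
    + intros n. apply Rmult_comm.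
  - intros n. now rewrite Row.
Qed.

(** * Power series in steps of two *)

Lemma PS_step2_S (d : nat) (c : nat -> R) (n : nat) :
  PS_step2 (S d) c n = PS_incr_1 (V := R_NormedModule) (PS_step2 d c) n.
Proof. destruct n; reflexivity. Qed.

Lemma PS_step2_at (d k : nat) (c : nat -> R) : PS_step2 d c (2 * k + d) = c k.
Proof.
  unfold PS_step2. replace (2 * k + d - d)%nat with (2 * k)%nat by lia.
  rewrite Nat.even_mul, Nat.div2_double, (proj2 (Nat.leb_le d (2 * k + d))) by lia.
  reflexivity.
Qed.

Lemma PS_step2_off (d k : nat) (c : nat -> R) : PS_step2 d c (2 * k + 1 + d) = 0.
Proof.
  unfold PS_step2. replace (2 * k + 1 + d - d)%nat with (2 * k + 1)%nat by lia.
  rewrite Nat.even_add, Nat.even_mul. simpl. now rewrite Bool.andb_false_r.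
Qed.

Lemma PS_step2_below (d n : nat) (c : nat -> R) : (n < d)%nat -> PS_step2 d c n = 0.
Proof. intros H. unfold PS_step2. rewrite (proj2 (Nat.leb_gt d n)) by trivial. reflexivity. Qed.

(** Case analysis on the index of a coefficient of a series in steps of two. *)
Lemma PS_step2_cases (d : nat) (P : nat -> Prop) :
  (forall n, (n < d)%nat -> P n) -> (forall k, P (2 * k + d)%nat) ->
  (forall k, P (2 * k + 1 + d)%nat) -> forall n, P n.
Proof.
  intros H0 H1 H2 n. destruct (Nat.lt_ge_cases n d) as [H|H]; [now apply H0|].
  destruct (Nat.Even_or_Odd (n - d)) as [[k E]|[k E]].
  - replace n with (2 * k + d)%nat by lia. apply H1.
  - replace n with (2 * k + 1 + d)%nat by lia. apply H2.
Qed.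

Lemma PS_mult_sum_n (a b : nat -> R) (n : nat) :
  PS_mult a b n = sum_n (fun k => a k * b (n - k)%nat) n.
Proof. symmetry. apply sum_n_Reals. Qed.

Lemma PS_mult_ext (a a' b b' : nat -> R) (n : nat) :
  (forall k, a k = a' k) -> (forall k, b k = b' k) -> PS_mult a b n = PS_mult a' b' n.
Proof.
  intros Ha Hb. rewrite !PS_mult_sum_n. apply sum_n_eq. intros k. now rewrite Ha, Hb.
Qed.

Lemma PS_mult_incr_l (a b : nat -> R) (n : nat) :
  PS_mult (PS_incr_1 (V := R_NormedModule) a) b n
  = PS_incr_1 (V := R_NormedModule) (PS_mult a b) n.
Proof.
  destruct n as [|n]; unfold PS_mult; simpl PS_incr_1.
  - simpl. unfold zero; simpl. ring.
  - rewrite decomp_sum by lia. simpl pred.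
    replace (PS_incr_1 (V := R_NormedModule) a 0) with 0 by reflexivity.
    rewrite Rmult_0_l, Rplus_0_l. reflexivity.
Qed.

Lemma PS_mult_incr_r (a b : nat -> R) (n : nat) :
  PS_mult a (PS_incr_1 (V := R_NormedModule) b) n
  = PS_incr_1 (V := R_NormedModule) (PS_mult a b) n.
Proof.
  destruct n as [|n].
  - unfold PS_mult. simpl. unfold zero; simpl. ring.
  - simpl PS_incr_1. rewrite !PS_mult_sum_n, sum_n_S, Nat.sub_diag.
    replace (PS_incr_1 (V := R_NormedModule) b 0) with 0 by reflexivity.
    rewrite Rmult_0_r, Rplus_0_r. apply sum_n_eq_loc. intros m Hm.
    now rewrite Nat.sub_succ_l.
Qed.

Lemma PS_incr_1_ext (a b : nat -> R) (n : nat) : (forall k, a k = b k) ->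
  PS_incr_1 (V := R_NormedModule) a n = PS_incr_1 (V := R_NormedModule) b n.
Proof. intros H. destruct n; simpl; trivial. Qed.

Lemma PS_mult_step2 (d e : nat) (c c' : nat -> R) (n : nat) :
  PS_mult (PS_step2 d c) (PS_step2 e c') n = PS_step2 (d + e) (PS_mult c c') n.
Proof.
  revert n. induction d as [|d IHd]; [induction e as [|e IHe]|]; intros n.
  - simpl. revert n. apply (PS_step2_cases 0); [lia|intros k|intros k].
    + rewrite PS_step2_at, Nat.add_0_r, !PS_mult_sum_n.
      assert (E : forall f : nat -> R, sum_n f (2 * k) = sum_n f (2 * k + 1) - f (2 * k + 1)%nat :> R).
      { intros f. replace (2 * k + 1)%nat with (S (2 * k)) by lia. rewrite sum_n_S. unfold Rminus. now rewrite Rplus_assoc, Rplus_opp_r, Rplus_0_r. }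
      rewrite E, sum_n_even_odd.
      assert (Z : forall i, PS_step2 0 c (2 * i + 1) = 0).
      { intros i. rewrite <- (PS_step2_off 0 i c). f_equal. lia. }
      rewrite Z, Rmult_0_l.
      rewrite (sum_n_eq (fun i => PS_step2 0 c (2 * i + 1) * PS_step2 0 c' (2 * k - (2 * i + 1))) (fun i => 0 * 0)).
      2: { intros i. rewrite Z. ring. }
      rewrite sum_n_Rscal, Rmult_0_l, Rminus_0_r, Rplus_0_r.
      apply sum_n_eq_loc. intros i Hi.
      rewrite <- (PS_step2_at 0 i c), <- (PS_step2_at 0 (k - i) c').
      do 2 f_equal; lia.
    + rewrite PS_step2_off, Nat.add_0_r, PS_mult_sum_n.
      rewrite (sum_n_eq_loc _ (fun i => 0 * 0)), sum_n_Rscal; [ring|].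
      intros i Hi. destruct (Nat.Even_or_Odd i) as [[j ->]|[j ->]].
      * replace (2 * k + 1 - 2 * j)%nat with (2 * (k - j) + 1 + 0)%nat by lia.
        rewrite PS_step2_off. ring.
      * replace (2 * j + 1)%nat with (2 * j + 1 + 0)%nat at 1 by lia.
        rewrite PS_step2_off. ring.
  - rewrite Nat.add_succ_r, PS_step2_S, <- (PS_incr_1_ext _ _ n IHe), <- PS_mult_incr_r.
    apply PS_mult_ext; trivial. intros k. apply PS_step2_S.
  - rewrite Nat.add_succ_l, PS_step2_S, <- (PS_incr_1_ext _ _ n IHd), <- PS_mult_incr_l.
    apply PS_mult_ext; trivial. intros k. apply PS_step2_S.
Qed.

(** * The Taylor series of the tangent *)

(** The coefficients of the sum of 2z / (N^2 - z^2) over the odd numbers N. They will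
    turn out to be those of (pi / 2) tan (pi z / 2). *)
Definition tan_coef : nat -> R := PS_step2 1 (fun k => 2 * lam (2 * (k + 1))).

Lemma lam_bounds (k : nat) : 0 <= lam (2 * (k + 1)) <= lam 2.
Proof.
  rewrite even_pow_index. split.
  - apply Series_nonneg; [|eexists; apply lam_is_series].
    intros n. apply Rlt_le, Rinv_0_lt_compat, pow_lt. generalize (oddR_ge1 n); lra.
  - apply Series_le; [|eexists; apply (lam_is_series 0)].
    intros n. assert (HX := oddR_ge1 n). split.
    + apply Rlt_le, Rinv_0_lt_compat, pow_lt. lra.
    + apply Rinv_le_contravar; [apply pow_lt; lra|]. apply Rle_pow; [lra|lia].
Qed.

Lemma lam_2_pos : 0 < lam 2.
Proof.
  apply Rlt_le_trans with (sum_n (fun n => / oddR n ^ 2) 0).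
  - rewrite sum_O. apply Rinv_0_lt_compat, pow_lt. generalize (oddR_ge1 0); lra.
  - apply sum_n_le_limit; [|apply (lam_is_series 0)].
    intros n. apply Rlt_le, Rinv_0_lt_compat, pow_lt. generalize (oddR_ge1 n); lra.
Qed.

Lemma tan_coef_bound (n : nat) : Rabs (tan_coef n) <= 2 * lam 2.
Proof.
  assert (H2 := lam_2_pos).
  revert n. apply (PS_step2_cases 1).
  - intros n Hn. unfold tan_coef. rewrite PS_step2_below, Rabs_R0 by trivial. lra.
  - intros k. unfold tan_coef. rewrite PS_step2_at. assert (H := lam_bounds k).
    rewrite Rabs_pos_eq; lra.
  - intros k. unfold tan_coef. rewrite PS_step2_off, Rabs_R0. lra.
Qed.

Lemma CV_radius_ge_1 (a : nat -> R) (M : R) :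
  (forall n, Rabs (a n) <= M) -> Rbar_le 1 (CV_radius a).
Proof.
  intros H. apply (proj1 (CV_radius_bounded a)). exists M.
  intros n. rewrite pow1, Rmult_1_r. apply H.
Qed.

Lemma tan_coef_CV (x : R) : Rabs x < 1 -> Rbar_lt (Rabs x) (CV_radius tan_coef).
Proof.
  intros H. apply Rbar_lt_le_trans with 1; [exact H|].
  exact (CV_radius_ge_1 _ _ tan_coef_bound).
Qed.

(** The Riccati equation T' = 2 lam(2) + T^2, coefficient by coefficient. *)
Lemma tan_coef_derive (n : nat) :
  PS_derive tan_coef n =
  PS_plus (V := R_NormedModule) (PS_const (2 * lam 2)) (PS_mult tan_coef tan_coef) n.
Proof.
  unfold PS_derive, tan_coef. change (PS_plus (V := R_NormedModule) ?a ?b n) with (a n + b n).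
  rewrite PS_mult_step2. simpl (1 + 1)%nat.
  revert n. apply (PS_step2_cases 2).
  - intros n Hn. rewrite (PS_step2_below 2) by trivial. destruct n as [|[|n]]; [| |lia].
    + change (PS_step2 1 ?c 1) with (PS_step2 1 c (2 * 0 + 1)). rewrite PS_step2_at. simpl. ring.
    + change (PS_step2 1 ?c 2) with (PS_step2 1 c (2 * 0 + 1 + 1)). rewrite PS_step2_off. simpl. ring.
  - intros k. rewrite PS_step2_at. replace (S (2 * k + 2)) with (2 * (k + 1) + 1)%nat by lia.
    rewrite PS_step2_at, PS_mult_sum_n.
    rewrite (sum_n_eq _ (fun i => 4 * (lam (2 * (i + 1)) * lam (2 * (k - i + 1))))) by (intros; ring).
    rewrite sum_n_Rscal, lam_convolution. replace (2 * (k + 1 + 1))%nat with (2 * k + 4)%nat by lia.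
    replace (PS_const (2 * lam 2) (2 * k + 2)) with 0 by (rewrite Nat.add_comm; reflexivity).
    rewrite <- oddR_INR. unfold oddR. rewrite plus_INR. simpl. field.
  - intros k. rewrite PS_step2_off. replace (S (2 * k + 1 + 2)) with (2 * (k + 1) + 1 + 1)%nat by lia.
    rewrite PS_step2_off. replace (PS_const (2 * lam 2) (2 * k + 1 + 2)) with 0
      by (rewrite Nat.add_comm; reflexivity). ring.
Qed.

Lemma PSeries_PS_const (c x : R) : is_series (fun n => PS_const c n * x ^ n) c.
Proof.
  apply is_series_shift. apply (is_series_eq _ _ _ _ is_series_zero).
  - intros n. simpl. ring.
  - simpl. ring.
Qed.

Lemma tan_series_Riccati (x : R) : Rabs x < 1 ->
  is_derive (PSeries tan_coef) x (2 * lam 2 + PSeries tan_coef x ^ 2).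
Proof.
  intros Hx. assert (HC := tan_coef_CV x Hx).
  apply (is_derive_eq _ _ _ _ (is_derive_PSeries tan_coef x HC)).
  rewrite (PSeries_ext _ _ x tan_coef_derive), PSeries_plus.
  - rewrite PSeries_mult by trivial. unfold PSeries at 1.
    rewrite (is_series_unique _ _ (PSeries_PS_const _ _)). ring.
  - exists (2 * lam 2). apply is_pseries_R, PSeries_PS_const.
  - now apply ex_pseries_mult.
Qed.

Lemma PSeries_tan_coef_0 : PSeries tan_coef 0 = 0.
Proof. rewrite PSeries_0. reflexivity. Qed.

(** Both sides vanish at 0 and have the same derivative, by the Riccati equation. *)
Lemma tan_series_atan (x : R) : Rabs x < 1 ->
  atan (PSeries tan_coef x / sqrt (2 * lam 2)) = sqrt (2 * lam 2) * x.
Proof.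
  assert (Hl := lam_2_pos).
  assert (Hs := sqrt_lt_R0 (2 * lam 2) ltac:(lra)).
  assert (Es := sqrt_sqrt (2 * lam 2) ltac:(lra)).
  set (s := sqrt (2 * lam 2)) in *.
  set (f := fun x => atan (PSeries tan_coef x / s) - s * x).
  assert (D : forall x, Rabs x < 1 -> is_derive f x 0).
  { intros y Hy.
    assert (D1 := is_derive_scal _ _ (/ s) _ (tan_series_Riccati y Hy)).
    assert (D2 := is_derive_comp atan _ y _ _ (is_derive_atan _) D1).
    assert (D3 := is_derive_scal _ y s _ (is_derive_id y)).
    assert (D4 := is_derive_minus _ _ y _ _ D2 D3).
    apply (is_derive_eq _ _ (minus (scal (/ s * (2 * lam 2 + PSeries tan_coef y ^ 2)) (/ (1 + (/ s * PSeries tan_coef y)²))) (s * 1))).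
    - apply (is_derive_ext (fun x => minus (atan (/ s * PSeries tan_coef x)) (s * x))).
      + intros t. unfold f, Rdiv. rewrite (Rmult_comm (/ s)). reflexivity.
      + exact D4.
    - unfold minus, plus, opp, scal; simpl; unfold mult; simpl. rewrite <- Es. unfold Rsqr.
      field. nra. }
  assert (F0 : f 0 = 0).
  { unfold f. rewrite PSeries_tan_coef_0. unfold Rdiv. rewrite Rmult_0_l, atan_0. ring. }
  intros Hx. assert (Hx' := Rabs_def2 _ _ Hx).
  assert (F : f x = 0).
  { destruct (Rtotal_order x 0) as [H|[->|H]]; trivial.
    - rewrite <- F0. apply (eq_is_derive (V := R_NormedModule) f x 0); trivial.
      intros t Ht. apply D, Rabs_def1; lra.
    - rewrite <- F0. symmetry. apply (eq_is_derive (V := R_NormedModule) f 0 x); trivial.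
      intros t Ht. apply D, Rabs_def1; lra. }
  unfold f in F. lra.
Qed.

(** At z = 1/2, the partial fractions 2z / (N^2 - z^2) sum to Leibniz's series. *)
Lemma tan_series_half : PSeries tan_coef (1 / 2) = PI / 2.
Proof.
  set (a := fun n k => 2 / oddR n ^ (2 * (k + 1)) * (1 / 2) ^ (2 * k + 1)).
  assert (HX := oddR_ge1).
  assert (Ha : forall n k, 0 <= a n k).
  { intros n k. unfold a. apply Rmult_le_pos; [|apply pow_le; lra].
    apply Rmult_le_pos; [lra|]. apply Rlt_le, Rinv_0_lt_compat, pow_lt. specialize (HX n). lra. }
  assert (Row : forall n, is_series (a n) (2 * (/ (4 * INR n + 1) - / (4 * INR n + 3)))).
  { intros n. specialize (HX n). assert (Hn := pos_INR n).
    assert (Hi : 0 < / oddR n <= 1).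
    { split; [apply Rinv_0_lt_compat; lra|]. rewrite <- Rinv_1. apply Rinv_le_contravar; lra. }
    assert (G : is_series (fun k => ((/ oddR n) ^ 2 / 4) ^ k) (/ (1 - (/ oddR n) ^ 2 / 4))).
    { apply is_series_geom. rewrite Rabs_pos_eq; nra. }
    apply (is_series_eq _ _ _ _ (is_series_Rscal ((/ oddR n) ^ 2) _ _ G)).
    - intros k. unfold a. rewrite even_pow_index, (pow_add (oddR n)), pow_mult, pow_add, pow_mult, pow_1.
      replace ((/ oddR n) ^ 2 / 4) with (/ oddR n ^ 2 * (1 / 2) ^ 2) by (rewrite pow_inv; field; lra).
      rewrite Rpow_mult_distr, !pow_inv. field. repeat split; repeat apply pow_nonzero; lra.
    - replace (4 * INR n + 1) with (2 * oddR n - 1) by (unfold oddR; ring).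
      replace (4 * INR n + 3) with (2 * oddR n + 1) by (unfold oddR; ring).
      field. repeat split; nra. }
  assert (Tot : is_series (fun n => Series (a n)) (PI / 2)).
  { apply (is_series_eq _ _ _ _ (is_series_Rscal 2 _ _ psi_zero_series)).
    - intros n. symmetry. exact (is_series_unique _ _ (Row n)).
    - rewrite psi_zero. field. }
  destruct (Fubini_nonneg a Ha (fun n => ex_intro _ _ (Row n)) (ex_intro _ _ Tot)) as [_ F].
  rewrite (is_series_unique _ _ Tot) in F.
  assert (Hser : is_series (fun n => tan_coef n * (1 / 2) ^ n) (PSeries tan_coef (1 / 2))).
  { apply Series_is, ex_series_Rabs, CV_disk_inside, tan_coef_CV. rewrite Rabs_pos_eq; lra. }
  replace (PI / 2) with (0 + PI / 2) by ring.
  refine (is_series_even_odd _ 0 (PI / 2) _ _ _ Hser).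
  - apply (is_series_eq _ _ _ _ is_series_zero); trivial.
    intros [|k]; [simpl; unfold tan_coef; rewrite PS_step2_below by lia; ring|].
    replace (2 * S k)%nat with (2 * k + 1 + 1)%nat by lia. unfold tan_coef.
    rewrite PS_step2_off. ring.
  - apply (is_series_eq _ _ _ _ F); trivial.
    intros k. unfold tan_coef. rewrite PS_step2_at. apply is_series_unique.
    apply (is_series_eq (fun n => 2 * (1 / 2) ^ (2 * k + 1) * / oddR n ^ (2 * k + 2)) _
            (2 * (1 / 2) ^ (2 * k + 1) * lam (2 * k + 2))).
    + apply is_series_Rscal, lam_is_series.
    + intros n. unfold a. rewrite even_pow_index. unfold Rdiv. ring.
    + rewrite even_pow_index. ring.
Qed.

(** Thus lam(2) = pi^2 / 8. With s the square root on the left,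
    [tan_series_atan] at 1/2 reads atan (pi / (2s)) = s / 2, and atan (pi / (2s))
    decreases with s. *)
Lemma sqrt_lam_2 : sqrt (2 * lam 2) = PI / 2.
Proof.
  assert (Hl := lam_2_pos).
  assert (Hs := sqrt_lt_R0 (2 * lam 2) ltac:(lra)).
  assert (E := tan_series_atan (1 / 2) ltac:(rewrite Rabs_pos_eq; lra)).
  rewrite tan_series_half in E. set (s := sqrt (2 * lam 2)) in *.
  assert (HP := PI_RGT_0).
  destruct (Rtotal_order s (PI / 2)) as [H|[H|H]]; trivial; exfalso.
  - assert (1 < PI / 2 / s).
    { apply Rmult_lt_reg_r with s; trivial. unfold Rdiv. rewrite (Rmult_assoc _ (/ s)), Rinv_l; lra. }
    assert (atan 1 < atan (PI / 2 / s)) by now apply atan_increasing.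
    rewrite atan_1 in *. lra.
  - assert (PI / 2 / s < 1).
    { apply Rmult_lt_reg_r with s; trivial. unfold Rdiv. rewrite (Rmult_assoc _ (/ s)), Rinv_l; lra. }
    assert (atan (PI / 2 / s) < atan 1) by now apply atan_increasing.
    rewrite atan_1 in *. lra.
Qed.

Lemma PS_taylor_tan (n : nat) : PS_taylor tan n = (2 / PI) ^ S n * tan_coef n.
Proof.
  assert (HP := PI_RGT_0). assert (HP3 := PI2_3_2).
  set (b := fun n => (2 / PI) ^ S n * tan_coef n).
  assert (HQ : 0 < 2 / PI < 1).
  { split; [apply Rdiv_lt_0_compat; lra|]. apply Rmult_lt_reg_r with PI; trivial.
    unfold Rdiv. rewrite Rmult_assoc, Rinv_l; lra. }
  assert (HC : Rbar_lt 0 (CV_radius b)).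
  { apply Rbar_lt_le_trans with 1; [simpl; lra|].
    apply (CV_radius_ge_1 _ (2 * lam 2)). intros k. unfold b. rewrite Rabs_mult.
    assert (H := pow_01 (2 / PI) (S k) ltac:(lra)). rewrite (Rabs_pos_eq (_ ^ S k)) by lra.
    assert (H1 := tan_coef_bound k). assert (H2 := Rabs_pos (tan_coef k)). nra. }
  assert (K : forall y, Rabs y < PI / 2 -> tan y = PSeries b y).
  { intros y Hy.
    assert (Hx : Rabs (2 / PI * y) < 1).
    { rewrite Rabs_mult, (Rabs_pos_eq (2 / PI)) by lra.
      apply Rmult_lt_reg_l with (PI / 2); [lra|].
      replace (PI / 2 * (2 / PI * Rabs y)) with (Rabs y) by (field; lra). lra. }
    assert (E := tan_series_atan _ Hx). rewrite sqrt_lam_2 in E.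
    replace (PI / 2 * (2 / PI * y)) with y in E by (field; lra).
    rewrite <- E at 1. rewrite tan_atan. unfold PSeries, Rdiv at 1. rewrite <- Series_scal_r.
    apply Series_ext. intros k. unfold b.
    rewrite Rpow_mult_distr. simpl pow. field. lra. }
  unfold PS_taylor. rewrite (Derive_n_ext_loc tan (PSeries b)).
  - rewrite Derive_n_coef by trivial. fold (b n). field. apply INR_fact_neq_0.
  - assert (Hd : 0 < PI / 2) by lra.
    exists (mkposreal _ Hd). intros y Hy. apply K.
    change (Rabs (y - 0) < PI / 2) in Hy. now rewrite Rminus_0_r in Hy.
Qed.

Lemma ztan_series_coef (n : nat) :
  ztan_series n = PS_step2 2 (fun k => 2 * lam (2 * (k + 1))) n.
Proof.
  rewrite PS_step2_S. assert (HP := PI_RGT_0).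
  destruct n as [|n]; unfold ztan_series, PS_dilate; simpl PS_incr_1.
  - unfold zero; simpl. ring.
  - change ((PI / 2) ^ S n * PS_taylor tan n = tan_coef n).
    rewrite PS_taylor_tan, <- Rmult_assoc, <- Rpow_mult_distr.
    replace (PI / 2 * (2 / PI)) with 1 by (field; lra). rewrite pow1. ring.
Qed.

(** * The coefficients of E and F *)

Lemma zeta_is_series (p : nat) :
  is_series (fun n => / INR (n + 1) ^ (p + 2)) (zeta (p + 2)).
Proof.
  apply Series_is. apply (ex_series_le_R _ (fun n => rho (INR n + 1))).
  - intros n. assert (Hn := pos_INR n). rewrite plus_INR. simpl (INR 1).
    rewrite Rabs_pos_eq by (apply Rlt_le, Rinv_0_lt_compat, pow_lt; lra).
    assert (Hs := sqrt_lt_R0 (INR n + 1) ltac:(lra)).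
    assert (Es := sqrt_sqrt (INR n + 1) ltac:(lra)).
    unfold rho. apply Rinv_le_contravar; [apply Rmult_lt_0_compat; lra|].
    rewrite pow_add. assert (1 <= (INR n + 1) ^ p) by (apply pow_R1_Rle; lra).
    assert (sqrt (INR n + 1) <= INR n + 1) by nra.
    assert ((INR n + 1) * sqrt (INR n + 1) <= (INR n + 1) ^ 2) by nra.
    assert (0 <= (INR n + 1) ^ 2) by apply pow2_ge_0. nra.
  - exists rho_sum. apply rho_is_series.
Qed.

Lemma lam_zeta (p : nat) : lam (p + 2) = (1 - (1 / 2) ^ (p + 2)) * zeta (p + 2).
Proof.
  enough (zeta (p + 2) = lam (p + 2) + (1 / 2) ^ (p + 2) * zeta (p + 2)) by lra.
  refine (is_series_even_odd _ _ _ _ _ _ (zeta_is_series p)).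
  - apply (is_series_eq _ _ _ _ (lam_is_series p)); trivial.
    intros n. now rewrite oddR_INR.
  - apply (is_series_eq _ _ _ _ (is_series_Rscal ((1 / 2) ^ (p + 2)) _ _ (zeta_is_series p))); trivial.
    intros n. assert (0 < INR (n + 1)) by (apply lt_0_INR; lia).
    replace (2 * n + 1 + 1)%nat with (2 * (n + 1))%nat by lia.
    rewrite mult_INR, Rpow_mult_distr, Rinv_mult. simpl (INR 2). f_equal.
    rewrite <- pow_inv. f_equal. lra.
Qed.

(** The values of h at 4j + 1, 4j + 2 and 4j + 3, with weights 1, -2 and 1. *)
Definition block (h : R -> R) (j : nat) : R :=
  h (4 * INR j + 1) - 2 * h (evenR j) + h (4 * INR j + 3).

Lemma oddR_double (j : nat) : oddR (2 * j) = 4 * INR j + 1 /\ oddR (2 * j + 1) = 4 * INR j + 3.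
Proof. unfold oddR. rewrite plus_INR, mult_INR. simpl. split; ring. Qed.

Lemma block_is_series (h : R -> R) (l l' : R) :
  is_series (fun n => h (oddR n)) l -> is_series (fun j => h (evenR j)) l' ->
  is_series (block h) (l - 2 * l').
Proof.
  intros H H'.
  apply (is_series_eq _ _ _ _ (is_series_Rminus _ _ _ _ (is_series_pairs _ _ H)
           (is_series_Rscal 2 _ _ H'))); trivial.
  intros j. unfold block. destruct (oddR_double j) as [-> ->]. ring.
Qed.

Lemma evenR_pow_is_series (p : nat) :
  is_series (fun j => / evenR j ^ (p + 2)) ((1 / 2) ^ (p + 2) * lam (p + 2)).
Proof.
  apply (is_series_eq _ _ _ _ (is_series_Rscal ((1 / 2) ^ (p + 2)) _ _ (lam_is_series p))); trivial.
  intros j. replace (evenR j) with (2 * oddR j) by (unfold evenR, oddR; ring).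
  rewrite Rpow_mult_distr, Rinv_mult, <- (pow_inv 2). replace (/ 2) with (1 / 2) by lra. ring.
Qed.

(** The coefficients of A(z/4) - 3 A(z/2) + 2 A(z) + log 2 as a series in z^2. *)
Definition alpha (i : nat) : R :=
  match i with
  | O => ln 2
  | S i' => ((1 / 4) ^ (2 * i) - 3 * (1 / 2) ^ (2 * i) + 2) * zeta (2 * i + 1)
  end.

(** For i = 0 this is the expansion of phi(0) = log(2) / 2, which converges only
    because the weights in a block add up to 0. *)
Lemma block_inv_pow (i : nat) :
  is_series (block (fun y => / y ^ (2 * i + 1))) (alpha i / 2).
Proof.
  destruct i as [|i].
  - simpl alpha. rewrite <- phi_zero.
    apply (is_series_eq _ _ _ _ (phi_series 0)); trivial.
    intros j. unfold block, evenR. simpl (2 * 0 + 1)%nat. rewrite !pow_1. simpl INR.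
    now rewrite !Rplus_0_l.
  - replace (2 * S i + 1)%nat with (2 * i + 1 + 2)%nat by lia.
    apply (is_series_eq _ _ _ _ (block_is_series (fun y => / y ^ (2 * i + 1 + 2)) _
            ((1 / 2) ^ (2 * i + 1 + 2) * lam (2 * i + 1 + 2)) (lam_is_series (2 * i + 1)) (evenR_pow_is_series (2 * i + 1)))); trivial.
    unfold alpha. replace (2 * S i + 1)%nat with (2 * i + 1 + 2)%nat by lia.
    rewrite lam_zeta. replace (1 / 4) with ((1 / 2) ^ 2) by field.
    rewrite <- pow_mult. replace (2 * i + 1 + 2)%nat with (2 * S i + 1)%nat by lia.
    replace (2 * (2 * S i))%nat with (2 * S i + 2 * S i)%nat by lia.
    rewrite !(pow_add (1 / 2)), pow_1. field.
Qed.

(** The sum of the kernel over the second variable for odd p = 2k + 1, in terms of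
    the coefficients alpha and of phi. *)
Lemma kernel_block_row (k n : nat) :
  is_series (block (kernel (2 * k + 1) (oddR n)))
    (sum_n (fun i => alpha i / 2 * / oddR n ^ (2 * (k - i + 1))) k
     - / oddR n ^ (2 * (k + 1)) * phi (2 * n + 1)).
Proof.
  assert (HX := oddR_ge1 n).
  assert (H1 : is_series (fun j => sum_n (fun i => / oddR n ^ (2 * (k - i + 1)) * block (fun y => / y ^ (2 * i + 1)) j) k)
     (sum_n (fun i => alpha i / 2 * / oddR n ^ (2 * (k - i + 1))) k)).
  { apply (is_series_sum_n (fun j i => / oddR n ^ (2 * (k - i + 1)) * block (fun y => / y ^ (2 * i + 1)) j)
             (fun i => alpha i / 2 * / oddR n ^ (2 * (k - i + 1)))).
    intros i. rewrite Rmult_comm. apply is_series_Rscal, block_inv_pow. }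
  apply (is_series_eq _ _ _ _ (is_series_Rminus _ _ _ _ H1
    (is_series_Rscal (/ oddR n ^ (2 * (k + 1))) _ _ (phi_series (2 * n + 1))))); trivial.
  intros j. assert (Hj := pos_INR j). unfold block.
  rewrite <- !kernel_odd_expansion by (unfold evenR; lra).
  rewrite <- oddR_INR. fold (evenR j).
  rewrite (sum_n_eq _ (fun i => / (4 * INR j + 1) ^ (2 * i + 1) * / oddR n ^ (2 * (k - i + 1))
    + (-2 * (/ evenR j ^ (2 * i + 1) * / oddR n ^ (2 * (k - i + 1)))
       + / (4 * INR j + 3) ^ (2 * i + 1) * / oddR n ^ (2 * (k - i + 1))))) by (intros; ring).
  rewrite !sum_n_Rplus, sum_n_Rscal. ring.
Qed.

(** The sum over N of [kernel_block_row], compared with the direct evaluation of the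
    kernel sums over the odd numbers and over the numbers congruent to 2 modulo 4. *)
Lemma phi_sum (k : nat) :
  is_series (fun n => phi (2 * n + 1) / oddR n ^ (2 * (k + 1)))
    (sum_n (fun i => alpha i / 2 * lam (2 * (k - i + 1))) k
     - (INR k + 1) * lam (2 * k + 3) + PI / 4 * beta (2 * k + 2)).
Proof.
  destruct (kernel_sum_plain (2 * k)) as [O1 O2].
  destruct (kernel_sum_even (2 * k)) as [E1 E2].
  replace (S (2 * k)) with (2 * k + 1)%nat in * by lia.
  replace (2 * k + 1 + 2)%nat with (2 * k + 3)%nat in * by lia.
  assert (H : is_series (fun n => sum_n (fun i => alpha i / 2 * / oddR n ^ (2 * (k - i + 1))) k)
     (sum_n (fun i => alpha i / 2 * lam (2 * (k - i + 1))) k)).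
  { apply (is_series_sum_n (fun n i => alpha i / 2 * / oddR n ^ (2 * (k - i + 1)))
             (fun i => alpha i / 2 * lam (2 * (k - i + 1)))).
    intros i. apply is_series_Rscal. rewrite even_pow_index. apply lam_is_series. }
  apply (is_series_eq _ _ _ _ (is_series_Rminus _ _ _ _ H
    (is_series_Rminus _ _ _ _ O2 (is_series_Rscal 2 _ _ E2)))).
  - intros n.
    assert (HR := is_series_limit_unique _ _ _ (kernel_block_row k n)
      (block_is_series (kernel (2 * k + 1) (oddR n)) _ _ (Series_is _ (O1 n)) (Series_is _ (E1 n)))).
    rewrite <- HR. unfold Rdiv. ring.
  - rewrite plus_INR, mult_INR. simpl (INR 2). simpl (INR 1). field.
Qed.

Lemma E_coefficient (k : nat) :
  E_series (2 * k + 2) =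
  - sum_n (fun i => alpha i * (2 * lam (2 * (k - i + 1)))) k
  - (2 * (INR k + 1) * ((1 / 2) ^ (2 * k + 2) - 2) * zeta (2 * k + 3)
     + PI * beta (2 * k + 2)).
Proof.
  unfold E_series. rewrite PS_step2_at.
  rewrite <- (is_series_unique _ _ (S_value_duality k)).
  apply is_series_unique.
  apply (is_series_eq _ _ _ _ (is_series_Rscal (-4) _ _ (phi_sum k))).
  - intros n. unfold Rdiv. ring.
  - rewrite (sum_n_eq (fun i => alpha i * _) (fun i => 4 * (alpha i / 2 * lam (2 * (k - i + 1))))) by (intros; field).
    rewrite sum_n_Rscal. replace (2 * k + 3)%nat with (2 * k + 1 + 2)%nat by lia.
    rewrite lam_zeta. replace (2 * k + 1 + 2)%nat with (2 * k + 2 + 1)%nat by lia.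
    rewrite (pow_add _ (2 * k + 2) 1), pow_1. field.
Qed.

Lemma F_coefficient (k : nat) :
  F_series (2 * k + 3) =
  - (2 * (2 * INR k + 3) * beta (2 * k + 4))
  + 2 * sum_n (fun i => 2 * lam (2 * (i + 1)) * beta (2 * (k - i + 1))) k.
Proof.
  unfold F_series. rewrite PS_step2_at.
  rewrite <- (is_series_unique _ _ (T_value_duality k)).
  rewrite (sum_n_eq _ (fun i => 2 * (lam (2 * (i + 1)) * beta (2 * (k - i + 1))))) by (intros; ring).
  rewrite sum_n_Rscal, lam_beta_convolution.
  rewrite (Series_ext _ (fun n => -4 * (psi (2 * n + 1) / oddR n ^ (2 * k + 3)))), Series_scal_l
    by (intros; unfold Rdiv; ring).
  field.
Qed.

Lemma A_combination (n : nat) :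
  (PS_dilate (1 / 4) A_series - 3 *: PS_dilate (1 / 2) A_series
     + 2 *: A_series + PS_const (ln 2))%ps n = PS_step2 0 alpha n.
Proof.
  change (PS_dilate (1 / 4) A_series n - 3 * PS_dilate (1 / 2) A_series n
     + 2 * A_series n + PS_const (ln 2) n = PS_step2 0 alpha n).
  unfold PS_dilate, A_series.
  revert n. apply (PS_step2_cases 2).
  - intros n Hn. rewrite PS_step2_below by trivial.
    destruct n as [|[|n]]; [| |lia]; unfold PS_step2; simpl; ring.
  - intros k. rewrite PS_step2_at.
    assert (E : PS_step2 0 alpha (2 * k + 2) = alpha (S k)).
    { rewrite <- (PS_step2_at 0 (S k) alpha). f_equal. lia. }
    rewrite E. unfold alpha. rewrite Nat.add_comm. simpl PS_const.
    replace (2 + 2 * k)%nat with (2 * S k)%nat by lia.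
    replace (2 * (k + 1) + 1)%nat with (2 * S k + 1)%nat by lia. ring.
  - intros k. rewrite PS_step2_off.
    assert (E : PS_step2 0 alpha (2 * k + 1 + 2) = 0).
    { rewrite <- (PS_step2_off 0 (S k) alpha). f_equal. lia. }
    rewrite E, Nat.add_comm. simpl PS_const. ring.
Qed.

Lemma PS_incr_derive (a : nat -> R) (n : nat) :
  PS_incr_1 (V := R_NormedModule) (PS_derive a) n = INR n * a n.
Proof. destruct n; simpl PS_incr_1; [simpl; symmetry; apply Rmult_0_l|reflexivity]. Qed.

Lemma E_identity (n : nat) :
  E_series n =
  ( - ((PS_dilate (1 / 4) A_series - 3 *: PS_dilate (1 / 2) A_series
          + 2 *: A_series + PS_const (ln 2)) * ztan_series)
      - PS_incr_1 ((1 / 2) *: PS_dilate (1 / 2) (PS_derive A_series)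
                   - 2 *: PS_derive A_series + PI *: D_series) )%ps n.
Proof.
  match goal with |- _ = PS_minus (PS_opp (PS_mult ?a ?b)) (PS_incr_1 ?c) n =>
    change (E_series n = - PS_mult a b n - PS_incr_1 (V := R_NormedModule) c n) end.
  rewrite (PS_mult_ext _ _ _ _ n A_combination ztan_series_coef), PS_mult_step2.
  simpl (0 + 2)%nat.
  assert (T : PS_incr_1 (V := R_NormedModule) ((1 / 2) *: PS_dilate (1 / 2) (PS_derive A_series)
                   - 2 *: PS_derive A_series + PI *: D_series)%ps n
    = ((1 / 2) ^ n - 2) * INR n * A_series n + PI * PS_step2 2 (fun m => beta (2 * (m + 1))) n).
  { rewrite (PS_step2_S 1). destruct n as [|n]; simpl PS_incr_1.
    - unfold zero; simpl. ring.
    - change (1 / 2 * ((1 / 2) ^ n * (INR (S n) * A_series (S n))) - 2 * (INR (S n) * A_series (S n))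
        + PI * D_series n = ((1 / 2) ^ S n - 2) * INR (S n) * A_series (S n) + PI * D_series n).
      simpl pow. ring. }
  rewrite T. clear T. unfold A_series.
  revert n. apply (PS_step2_cases 2).
  - intros n Hn. unfold E_series. rewrite !PS_step2_below by trivial. ring.
  - intros k. rewrite E_coefficient, !PS_step2_at, PS_mult_sum_n.
    replace (2 * (k + 1) + 1)%nat with (2 * k + 3)%nat by lia.
    replace (2 * (k + 1))%nat with (2 * k + 2)%nat by lia.
    rewrite (plus_INR (2 * k) 2), mult_INR. simpl (INR 2). ring.
  - intros k. unfold E_series. rewrite !PS_step2_off. ring.
Qed.

Lemma F_identity (n : nat) :
  F_series n =
  ( (2 * beta 2) *: PS_incr_1 (PS_const 1)
      - 2 *: PS_incr_1 (PS_derive D_series)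
      + 2 *: (ztan_series * D_series) )%ps n.
Proof.
  change (F_series n = 2 * beta 2 * PS_incr_1 (V := R_NormedModule) (PS_const 1) n
    - 2 * PS_incr_1 (V := R_NormedModule) (PS_derive D_series) n
    + 2 * PS_mult ztan_series D_series n).
  rewrite PS_incr_derive.
  rewrite (PS_mult_ext _ _ _ D_series n ztan_series_coef (fun _ => eq_refl)).
  unfold D_series. rewrite PS_mult_step2. simpl (2 + 1)%nat.
  revert n. apply (PS_step2_cases 3).
  - intros n Hn. unfold F_series. rewrite !(PS_step2_below 3) by trivial.
    destruct n as [|[|[|n]]]; [| | |lia]; unfold PS_step2; simpl; unfold zero; simpl; ring.
  - intros k. rewrite F_coefficient, PS_step2_at, PS_mult_sum_n.
    replace (2 * k + 3)%nat with (2 * (k + 1) + 1)%nat at 1 2 3 by lia. rewrite PS_step2_at.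
    replace (2 * (k + 1 + 1))%nat with (2 * k + 4)%nat by lia.
    replace (PS_incr_1 (V := R_NormedModule) (PS_const 1) (2 * (k + 1) + 1)) with 0
      by (replace (2 * (k + 1) + 1)%nat with (S (S (2 * k + 1))) by lia; reflexivity).
    rewrite <- oddR_INR. unfold oddR. rewrite plus_INR. simpl (INR 1). ring.
  - intros k. unfold F_series. rewrite !(PS_step2_off 3).
    replace (2 * k + 1 + 3)%nat with (2 * (k + 1) + 1 + 1)%nat by lia. rewrite PS_step2_off.
    replace (2 * (k + 1) + 1 + 1)%nat with (S (S (2 * (k + 1)))) by lia. simpl PS_incr_1.
    unfold PS_const. ring.
Qed.

Theorem theorem1 (n : nat) :
  PS_complex E_series F_series n =
  PS_complex
    ( - ((PS_dilate (1 / 4) A_series - 3 *: PS_dilate (1 / 2) A_series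
          + 2 *: A_series + PS_const (ln 2)) * ztan_series)
      - PS_incr_1 ((1 / 2) *: PS_dilate (1 / 2) (PS_derive A_series)
                   - 2 *: PS_derive A_series + PI *: D_series) )%ps
    ( (2 * beta 2) *: PS_incr_1 (PS_const 1)
      - 2 *: PS_incr_1 (PS_derive D_series)
      + 2 *: (ztan_series * D_series) )%ps
    n.
Proof.
  unfold PS_complex. now rewrite <- E_identity, <- F_identity.
Qed.
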